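(* Let $\Lambda=\mathrm{diag}(\lambda_1<\cdots<\lambda_n)$ be a real diagonal matrix with simple spectrum and let $\sigma:\mathcal{T}_\Lambda\to\mathbb{R}$ be a simple shift strategy. For $\epsilon>0$ small enough, each deflation neighborhood $\mathcal{D}^i_{\Lambda,\epsilon}$, $i=1,\dots,n$, is invariant under $F_\sigma$ (that is, $F_\sigma(\mathcal{D}^i_{\Lambda,\epsilon})\subset\mathcal{D}^i_{\Lambda,\epsilon}$). There exists $C>0$ such that, for all $T\in\mathcal{D}_{\Lambda,\epsilon}$, $|b(F_\sigma(T))|\le C|b(T)|^2$. Also, given a compact set $\mathcal{K}\subset\mathcal{D}_{\Lambda,\epsilon}$ disjoint from $\mathcal{S}_\sigma\cap\mathcal{D}_{\Lambda,0}$, there exists $C_{\mathcal{K}}>0$ such that, for all $T\in\mathcal{K}$, $|b(F_\sigma(T))|\le C_{\mathcal{K}}|b(T)|^3$.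
   Context: $\mathcal{T}_\Lambda$ is the set of real symmetric tridiagonal $n\times n$ matrices with spectrum $\{\lambda_1,\dots,\lambda_n\}$ (a connected compact smooth manifold); $b(T)=(T)_{n,n-1}$. $\mathcal{E}$ is the group of diagonal matrices with diagonal entries $\pm1$. Steps: an $n\times n$ real matrix is almost invertible if its first $n-1$ columns are linearly independent. Every almost invertible $M$ has a unique factorization $M=Q_\star R_\star$ with $Q_\star\in SO(n)$ and $R_\star$ upper triangular with $(R_\star)_{j,j}>0$ for $j=1,\dots,n-1$. If $T-sI$ is almost invertible and $T-sI=Q_\star R_\star$, put $F_s(T)=Q_\star^{*}TQ_\star$. For $\sigma:\mathcal{T}_\Lambda\to\mathbb{R}$ put $F_\sigma(T)=F_{\sigma(T)}(T)$; its natural domain is the set of $T$ for which $T-\sigma(T)I$ is almost invertible. A simple shift strategy is a function $\sigma:\mathcal{T}_\Lambda\to\mathbb{R}$ with $\sigma(ETE)=\sigma(T)$ for all $T\in\mathcal{T}_\Lambda$ and all $E\in\mathcal{E}$, for which there exists $C_\sigma>0$ such that for all $T\in\mathcal{T}_\Lambda$ there is an eigenvalue $\lambda_i$ with $|\sigma(T)-\lambda_i|\le C_\sigma|b(T)|$. No continuity of $\sigma$ is assumed. The singular support $\mathcal{S}_\sigma\subset\mathcal{T}_\Lambda$ is the minimal closed subset of $\mathcal{T}_\Lambda$ on whose complement $\sigma$ is smooth. Deflation sets: $\mathcal{D}^i_{\Lambda,0}=\{T\in\mathcal{T}_\Lambda: b(T)=0,\ (T)_{n,n}=\lambda_i\}$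 (connected), $\mathcal{D}_{\Lambda,0}=\bigcup_i\mathcal{D}^i_{\Lambda,0}=\{T\in\mathcal{T}_\Lambda: b(T)=0\}$, $\mathcal{D}_{\Lambda,\epsilon}=\{T\in\mathcal{T}_\Lambda: |b(T)|\le\epsilon\}$, and $\mathcal{D}^i_{\Lambda,\epsilon}$ is the connected component of $\mathcal{D}_{\Lambda,\epsilon}$ containing $\mathcal{D}^i_{\Lambda,0}$ (for small $\epsilon$ there are exactly $n$ components, and $\mathcal{D}^i_{\Lambda,\epsilon}=\{T\in\mathcal{D}_{\Lambda,\epsilon}: |(T)_{n,n}-\lambda_i|<\sqrt2\,\epsilon\}$).
   Formalization: The shift strategy is also assumed to satisfy: for some δ>0 and all i and T in D^i_{Λ,δ}, λ_i is an eigenvalue nearest to σ(T); without this the claim fails, e.g. for n=2 and constant σ=λ_2, where F_σ sends unreduced T in D^1_{Λ,ε} into D^2_{Λ,0}. *)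

(* Defs.v *)
From HB Require Import structures.
From mathcomp Require Import all_boot all_order all_algebra.
From mathcomp Require Import all_classical all_reals all_analysis.

Set Implicit Arguments.
Unset Strict Implicit.
Unset Printing Implicit Defensive.

Import Order.TTheory GRing.Theory Num.Theory.
Import numFieldNormedType.Exports.

Local Open Scope classical_set_scope.
Local Open Scope ring_scope.

(* Matrices have size n.+2, so that the entry in the last row, one column     *)
(* before the last, exists; their topology is the product topology.           *)

Section Smoothness.
Context {R : realType} {V : normedModType R}.
Implicit Types (f g : V -> R) (A U Z : set V).

Fixpoint iter_derive (vs : seq V) f : V -> R :=
  if vs is v :: vs' then 'D_v (iter_derive vs' f) else f.

(* C^infinity, for U open and V finite-dimensional *)
Definition smooth_on_open U g : Prop :=
  forall (vs : seq V) x, U x -> differentiable (iter_derive vs g) x.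

(* Smoothness on an arbitrary subset A: f is locally the restriction to A of  *)
(* a smooth function on an open set. When A is an open subset of a            *)
(* submanifold of V, this is smoothness of f as a function on the manifold A. *)
Definition smooth_on A f : Prop :=
  forall x, A x -> exists (U : set V) (g : V -> R),
    [/\ open U, U x, smooth_on_open U g & {in U `&` A, f =1 g}].

(* The intersection of all relatively closed subsets of X on whose complement *)
(* in X the function f is smooth; the next two lemmas say that it is the      *)
(* minimum of this family.                                                    *)
Definition singular_support (X : set V) f : set V :=
  X `&` \bigcap_(Z in [set Z | closed Z /\ smooth_on (X `\` Z) f]) Z.

Lemma singular_support_smooth (X : set V) f :
  (exists2 Z, closed Z & singular_support X f = X `&` Z) /\
  smooth_on (X `\` singular_support X f) f.
Proof.
split.
  eexists; last reflexivity.
  by apply: closed_bigI => Z [].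
move=> x [Xx nSx].
have [Z [[cZ sZ] nZx]] : exists Z, (closed Z /\ smooth_on (X `\` Z) f) /\ ~ Z x.
  apply: contrapT => nex; apply: nSx; split => // Z ZP.
  by apply: contrapT => nZx; apply: nex; exists Z.
have [U [g [oU Ux sg fg]]] := sZ x (conj Xx nZx).
exists (U `&` ~` Z), g; split => //.
- by apply: openI => //; exact: closed_openC.
- by move=> vs y [Uy _]; exact: sg.
- move=> y; rewrite inE => -[[Uy nZy] [Xy _]].
  by apply: fg; rewrite inE.
Qed.

Lemma singular_support_min (X Z : set V) f :
  closed Z -> smooth_on (X `\` Z) f -> singular_support X f `<=` X `&` Z.
Proof. by move=> cZ sZ x [Xx Sx]; split => //; apply: Sx. Qed.

End Smoothness.

Section ShiftedQR.
Context {R : realType} {n : nat}.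
Implicit Types (lam : 'I_n.+2 -> R) (sigma : 'M[R]_n.+2 -> R).
Implicit Types (s eps : R) (i : 'I_n.+2) (E M Q U T : 'M[R]_n.+2).

Definition tridiagonal T : Prop :=
  forall i j : 'I_n.+2, (i.+1 < j)%N || (j.+1 < i)%N -> T i j = 0.

(* For n.+2 distinct values lam i, having these as eigenvalues fixes the      *)
(* multiplicities as well.                                                    *)
Definition TLambda lam : set 'M[R]_n.+2 :=
  [set T | [/\ T^T = T, tridiagonal T &
             [set x | eigenvalue T x] = range lam]].

Definition bot T : R := T ord_max (inord n).

Definition sign_diag E : Prop :=
  is_diag_mx E /\ forall i, E i i = 1 \/ E i i = -1.

Definition almost_invertible M : Prop := row_free (col' ord_max M)^T.

Definition QRstar M Q U : Prop :=
  [/\ M = Q *m U,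
      Q^T *m Q = 1%:M /\ \det Q = 1,
      forall i j : 'I_n.+2, (j < i)%N -> U i j = 0 &
      forall j : 'I_n.+2, j != ord_max -> 0 < U j j].

(* Meaningful only for almost invertible M, in which case the factorization   *)
(* exists and is unique; the value is 1%:M when there is no factorization.    *)
Definition Qstar M : 'M[R]_n.+2 :=
  xget 1%:M [set Q | exists U, QRstar M Q U].

Definition Fshift s T : 'M[R]_n.+2 :=
  (Qstar (T - s%:M))^T *m T *m Qstar (T - s%:M).

Definition Fsigma sigma T : 'M[R]_n.+2 := Fshift (sigma T) T.

Definition Fsigma_dom lam sigma : set 'M[R]_n.+2 :=
  [set T | TLambda lam T /\ almost_invertible (T - (sigma T)%:M)].

(* Only the values of sigma on TLambda lam matter. *)
Definition simple_shift_strategy lam sigma : Prop :=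
  (forall T E, TLambda lam T -> sign_diag E ->
     sigma (E *m T *m E) = sigma T) /\
  (exists2 C : R, 0 < C & forall T, TLambda lam T ->
     exists i, `|sigma T - lam i| <= C * `|bot T|).

Definition deflation0 lam : set 'M[R]_n.+2 :=
  [set T | TLambda lam T /\ bot T = 0].

Definition deflation0_at lam i : set 'M[R]_n.+2 :=
  [set T | [/\ TLambda lam T, bot T = 0 & T ord_max ord_max = lam i]].

Definition deflation lam eps : set 'M[R]_n.+2 :=
  [set T | TLambda lam T /\ `|bot T| <= eps].

(* As deflation0_at lam i is connected, this is the one connected component   *)
(* of deflation lam eps that contains it.                                     *)
Definition deflation_at lam eps i : set 'M[R]_n.+2 :=
  \bigcup_(T0 in deflation0_at lam i)
    connected_component (deflation lam eps) T0.

(* simple_shift_strategy lets the eigenvalue approximated by sigma T depend   *)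
(* on T in any way. This says that, near deflation0_at lam i, it is lam i.    *)
(* Without it the constant strategy sigma = lam j sends every unreduced       *)
(* matrix near deflation0_at lam i to deflation0_at lam j, also for j != i.   *)
Definition deflation_compatible lam sigma : Prop :=
  exists2 delta : R, 0 < delta & forall i T, deflation_at lam delta i T ->
    forall j, `|sigma T - lam i| <= `|sigma T - lam j|.

End ShiftedQR.

(* Main.v *)
Require Import Defs.
From HB Require Import structures.
From mathcomp Require Import all_boot all_order all_algebra.
From mathcomp Require Import all_classical all_reals all_analysis.
From mathcomp Require Import ring lra zify.

Set Implicit Arguments.
Unset Strict Implicit.
Unset Printing Implicit Defensive.

Import Order.TTheory GRing.Theory Num.Theory.
Import numFieldNormedType.Exports.

Local Open Scope classical_set_scope.
Local Open Scope ring_scope.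

(** Let the rows of an orthogonal V be unit eigenvectors of T, and let the
    weights w_j = (V j ord_max) ^+ 2 be the squared last coordinates of the
    eigenvectors; they sum to 1. The last row of a symmetric tridiagonal T has
    only the two entries b = bot T and c in it, so, for every z,

      sum_j w_j (lam_j - z)^2 = b^2 + (c - z)^2         [weight_moment].

    Hence b^2 is the variance of the spectral measure with masses w_j at lam_j:
    if b is small, this measure is concentrated at one eigenvalue lam_i, and
    the mass elsewhere is at most 4 b^2 / g^2, where g is the smallest gap
    between eigenvalues.

    If s is not an eigenvalue, a step with shift s replaces the last basis
    vector e by a unit vector along (T - s)^-1 e. It multiplies the
    eigencoordinates of e by a common factor times 1 / (lam_j - s), so for s
    near lam_i it damps the mass away from lam_i, and

      |b(F_s T)| <= (6 / g) |s - lam_i| |b(T)|   [shifted_moment, shift_step].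

    As |sigma T - lam_i| <= C |b(T)|, this is the quadratic estimate, and it
    keeps |b| small. The cubic estimate follows if |sigma T - lam_i| = O(b^2)
    near each point T0 of K. Where b(T0) <> 0 the quadratic estimate is enough;
    otherwise sigma extends to a smooth function f around T0. Flipping the sign
    of the last basis vector changes T = m + b H into m - b H, where m is T with
    b replaced by 0 and H is a fixed matrix, and sigma takes the same value at
    both. The second difference of f gives sigma T = f m + O(b^2). The matrix m
    need not have the spectrum of T, but it is within O(b^2) of a deflated
    matrix T1 that has it, and f T1 = sigma T1 = lam_i [quadratic_near_regular].

    The matrix T1 is the end of a path that also describes the components of
    the deflation neighborhoods. Let v be the unit eigenvector of lam_i, factor
    1 - t v v^T = Q_t R_t and put T_t = Q_t^T T Q_t, for t from 0 to 1. All
    T_t are tridiagonal with the spectrum of T; all weights but the i-th are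
    multiplied by one ratio, which is at most 1 and vanishes at t = 1. When w_i
    is at least 1/2, the variance never exceeds its initial value, so the path
    joins T to the deflated T_1 = T1 inside the neighborhood
    [deflation_at_weight]. Conversely the corner entry c cannot leave the
    vicinity of lam_i along a component [deflation_at_corner]. Both Q_t and the
    step need only a QR factorization that is continuous in a parameter; the
    distance from T1 to m is read off from the Cholesky factor of a matrix near
    the identity [cholesky_near_identity]. *)

(** * Triangular matrices and Gram-Schmidt orthogonalization *)

Section Upper.
Context {R : realType} {N : nat}.
Implicit Types U W Q : 'M[R]_N.

Definition upper U := forall i j : 'I_N, (j < i)%N -> U i j = 0.

Lemma upper_mul U W : upper U -> upper W -> upper (U *m W).
Proof.
move=> hU hW i j ji; rewrite mxE big1 // => k _.
have [ki|ik] := ltnP k i; first by rewrite hU ?mul0r.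
by rewrite hW ?mulr0 // (leq_trans ji).
Qed.

Lemma upper_mul_diag U W j : upper U -> upper W ->
  (U *m W) j j = U j j * W j j.
Proof.
move=> hU hW; rewrite mxE (bigD1 j) //= big1 ?addr0 // => k kj.
have [ki|ik] := ltnP k j; first by rewrite hU ?mul0r.
by rewrite hW ?mulr0 // ltn_neqAle ik eq_sym kj.
Qed.

Lemma upper_unit U : upper U -> (forall j, U j j != 0) -> U \in unitmx.
Proof.
move=> hU d0; rewrite unitmxE -det_tr det_trig; last first.
  by apply/is_trig_mxP => i j ij; rewrite mxE hU.
by rewrite unitfE; apply/prodf_neq0 => i _; rewrite mxE.
Qed.

Lemma upper_inv U : upper U -> (forall j, U j j != 0) ->
  upper (invmx U) /\ forall j, invmx U j j = (U j j)^-1.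
Proof.
move=> hU d0; have uU := upper_unit hU d0.
have UW i j : (U *m invmx U) i j = (i == j)%:R by rewrite mulmxV // mxE.
have up : upper (invmx U).
  suff H m (i j : 'I_N) : (N - i <= m)%N -> (j < i)%N -> invmx U i j = 0.
    by move=> i j; apply: (H N); apply: leq_subr.
  elim: m i j => [|m IH] i j im ji.
    by move: im; rewrite leqn0 subn_eq0 leqNgt ltn_ord.
  have := UW i j; rewrite mxE (bigD1 i) //= big1 ?addr0.
    move=> e; apply: (mulfI (d0 i)); rewrite e mulr0.
    by rewrite -val_eqE /= gtn_eqF.
  move=> k ki; have [kli|ik] := ltnP k i; first by rewrite hU ?mul0r.
  have {}ik : (i < k)%N by rewrite ltn_neqAle ik eq_sym ki.
  rewrite IH ?mulr0 //; last exact: ltn_trans ik.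
  by have := ltn_ord k; lia.
split=> // j; apply: (mulfI (d0 j)).
by rewrite -upper_mul_diag // UW eqxx divff.
Qed.

End Upper.

Section ContinuousMatrices.
Context {R : realType} {X : topologicalType}.

Lemma continuous_mxP m n (A : X -> 'M[R]_(m, n)) :
  continuous A <-> forall i j, continuous (fun x => A x i j).
Proof.
split=> [cA i j x|cA x].
  apply: (@continuous_comp _ _ _ A (fun M : 'M[R]_(m, n) => M i j)).
    exact: cA.
  exact: coord_continuous.
move=> P [B hB sB].
have : \forall y \near x, forall i j, B i j (A y i j).
  apply: filter_forall => i; apply: filter_forall => j.
  exact: (cA i j x _ (hB i j)).
by apply: filterS => y; apply: sB.
Qed.

Lemma continuous_mx_entry m n (A : X -> 'M[R]_(m, n)) i j :
  continuous A -> continuous (fun x => A x i j).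
Proof. by move=> /continuous_mxP. Qed.

Lemma continuous_mulmx m n p (A : X -> 'M[R]_(m, n)) (B : X -> 'M[R]_(n, p)) :
  continuous A -> continuous B -> continuous (fun x => A x *m B x).
Proof.
move=> /continuous_mxP cA /continuous_mxP cB; apply/continuous_mxP => i j.
under eq_fun do rewrite mxE.
apply: continuous_big => [|k _]; first exact: add_continuous.
by move=> x; apply: continuousM; [apply: cA|apply: cB].
Qed.

Lemma continuous_trmx m n (A : X -> 'M[R]_(m, n)) :
  continuous A -> continuous (fun x => (A x)^T).
Proof.
move=> /continuous_mxP cA; apply/continuous_mxP => i j.
by under eq_fun do rewrite mxE; exact: cA.
Qed.

End ContinuousMatrices.

Section MatrixNorm.
Context {R : realType} {m n : nat}.
Implicit Types M : 'M[R]_(m, n).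

Lemma mx_norm_le M c : 0 <= c -> (forall i j, `|M i j| <= c) -> `|M| <= c.
Proof.
move=> c0 hM; rewrite -[leLHS]/(mx_norm M) mx_normrE.
by apply: bigmax_le => // -[i j] _; exact: hM.
Qed.

Lemma mx_norm_ge M i j : `|M i j| <= `|M|.
Proof.
rewrite -[leRHS]/(mx_norm M) mx_normrE.
by apply: (le_bigmax _ (fun ij : 'I_m * 'I_n => `|M ij.1 ij.2|) (i, j)).
Qed.

End MatrixNorm.

Section GramSchmidt.
Context {R : realType} {X : topologicalType} {N : nat}.
Implicit Types Q A U : X -> 'M[R]_N.

Lemma dot_gt0 (y : 'cV[R]_N) : y != 0 -> 0 < \sum_i y i 0 ^+ 2.
Proof.
move=> y0; have h i : true -> 0 <= y i 0 ^+ 2 by rewrite sqr_ge0.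
rewrite lt_def sumr_ge0 // andbT; apply: contra y0 => /eqP e.
apply/eqP/colP => i; rewrite mxE; apply/eqP; rewrite -sqrf_eq0; apply/eqP.
exact: (psumr_eq0P h e).
Qed.

(** One column at a time, so that each of the formulas involved is explicit and
    continuity in the parameter x can be read off from it. *)
Lemma gram_schmidt_step (k : 'I_N) Q :
  continuous Q -> (forall x, Q x \in unitmx) ->
  (forall x (i j : 'I_N), (i < k)%N -> (j < k)%N ->
     ((Q x)^T *m Q x) i j = (i == j)%:R) ->
  exists Q' S : X -> 'M[R]_N,
  [/\ continuous Q',
      forall x, Q x = Q' x *m S x,
      forall x, upper (S x) /\ forall j, 0 < S x j j &
      forall x (i j : 'I_N), (i <= k)%N -> (j <= k)%N ->
        ((Q' x)^T *m Q' x) i j = (i == j)%:R].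
Proof.
move=> cQ uQ oQ.
pose G x := (Q x)^T *m Q x.
have cG : continuous G by apply: continuous_mulmx => //; exact: continuous_trmx.
(* coordinates, in the columns of Q, of column k minus its projections *)
pose c x : 'cV[R]_N := \col_j (if (j < k)%N then - G x j k else (j == k)%:R).
have cc : continuous c.
  apply/continuous_mxP => i j; under eq_fun do rewrite mxE.
  case: ltnP => _; last by move=> x; exact: cvg_cst.
  by move=> x; apply: continuousN; exact: continuous_mx_entry.
pose y x := Q x *m c x.
have cy : continuous y by exact: continuous_mulmx.
have yE x l : y x l 0 = Q x l k - \sum_(j < N | (j < k)%N) Q x l j * G x j k.
  rewrite mxE (bigID (fun j : 'I_N => (j < k)%N)) /= addrC; congr (_ + _).
    rewrite (bigD1 k) ?ltnn //= mxE ltnn eqxx mulr1 big1 ?addr0 // => j.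
    by case/andP => /negbTE h1 /negbTE h2; rewrite mxE h1 h2 mulr0.
  rewrite -sumrN; apply: eq_bigr => j jk.
  by rewrite mxE jk mulrN.
have y0 x : y x != 0.
  apply/eqP => /(congr1 (mulmx (invmx (Q x)))).
  rewrite mulKmx // mulmx0 => /colP /(_ k); rewrite !mxE ltnn eqxx.
  by move/eqP; rewrite oner_eq0.
pose d x := Num.sqrt (\sum_l y x l 0 ^+ 2).
have d_gt0 x : 0 < d x by rewrite sqrtr_gt0 dot_gt0.
have d2 x : d x ^+ 2 = \sum_l y x l 0 ^+ 2.
  by rewrite sqr_sqrtr // ltW // dot_gt0.
have cd : continuous d.
  pose sq x := \sum_l y x l 0 ^+ 2.
  move=> x; apply: (@continuous_comp _ _ _ sq); last exact: sqrt_continuous.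
  move: x; apply: continuous_big => [|l _ x]; first exact: add_continuous.
  have h : {for x, continuous (fun x => y x l 0)}.
    by apply: continuous_mx_entry.
  exact: (continuousM h h).
have ortho x (i : 'I_N) : (i < k)%N -> \sum_l Q x l i * y x l 0 = 0.
  move=> ik.
  have -> : \sum_l Q x l i * y x l 0 = (G x *m c x) i 0.
    rewrite -mulmxA mxE; apply: eq_bigr => l _.
    by rewrite [X in _ = X * _]mxE.
  rewrite mxE (bigID (fun j : 'I_N => (j < k)%N)) /=.
  rewrite (bigD1 i) //= [X in _ + X + _]big1 => [|j /andP[jk ji]]; last first.
    by rewrite /G oQ // eq_sym (negbTE ji) mul0r.
  rewrite [c x i _]mxE ik {1}/G oQ // eqxx mul1r addr0 (bigD1 k) ?ltnn //=.
  rewrite [c x k _]mxE ltnn eqxx mulr1 big1 ?addr0 ?addNr // => j.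
  by case/andP => /negbTE h1 /negbTE h2; rewrite [c x j _]mxE h1 h2 mulr0.
pose Q' x : 'M[R]_N :=
  \matrix_(i, j) if j == k then y x i 0 / d x else Q x i j.
(* the elementary triangular matrix that undoes the change of column k *)
pose S x : 'M[R]_N := \matrix_(i, j) if j == k then
  (if (i < k)%N then G x i k else if i == k then d x else 0) else (i == j)%:R.
exists Q', S; split.
- apply/continuous_mxP => i j; under eq_fun do rewrite mxE.
  case: eqP => _; last by move=> x; apply: continuous_mx_entry.
  move=> x; apply: (@continuousM _ _ (fun x => y x i 0) (fun x => (d x)^-1)).
    by apply: continuous_mx_entry.
  apply: continuousV; last exact: cd.
  by rewrite gt_eqF.
- move=> x; apply/matrixP => i j; rewrite [RHS]mxE.
  have [->|jk] := eqVneq j k; last first.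
    rewrite (bigD1 j) //= big1 => [|l lj]; last first.
      by rewrite [S x l j]mxE (negbTE jk) (negbTE lj) mulr0.
    by rewrite !mxE (negbTE jk) eqxx mulr1 addr0.
  rewrite (bigID (fun j : 'I_N => (j < k)%N)) /= addrC.
  rewrite (bigD1 k) ?ltnn //= big1 => [|l]; last first.
    by case/andP => /negbTE h1 /negbTE h2; rewrite [S x l k]mxE eqxx h1 h2 mulr0.
  rewrite [Q' x i k]mxE [S x k k]mxE !eqxx ltnn yE addr0 divfK ?gt_eqF //.
  rewrite -addrA addrC -{1}(add0r (Q x i k)); congr (_ + _).
  rewrite -sumrN -big_split /= big1 // => l lk.
  rewrite [Q' x i l]mxE [S x l k]mxE eqxx lk.
  rewrite (_ : (l == k) = false) ?addNr //.
  by apply/negbTE; rewrite -val_eqE neq_ltn lk.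
- move=> x; split=> [i j ji|j]; rewrite mxE.
    have [jk|jk] := eqVneq j k; last by rewrite -val_eqE gtn_eqF.
    by rewrite -jk ltnNge ltnW //= -val_eqE gtn_eqF.
  by have [->|//] := eqVneq j k; rewrite ?ltnn ?eqxx ?d_gt0.
- have yy x : \sum_l (y x l 0 / d x) * (y x l 0 / d x) = 1.
    under eq_bigr do rewrite mulrACA -expr2.
    rewrite -mulr_suml -d2 -invfM -expr2 divff //.
    by rewrite sqrf_eq0 gt_eqF.
  have oy x (i : 'I_N) : (i < k)%N -> \sum_l Q x l i * (y x l 0 / d x) = 0.
    move=> ik; under eq_bigr do rewrite mulrA.
    by rewrite -mulr_suml ortho // mul0r.
  have E x i j : ((Q' x)^T *m Q' x) i j = \sum_l Q' x l i * Q' x l j.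
    by rewrite mxE; apply: eq_bigr => l _; rewrite mxE.
  move=> x i j ik jk; rewrite E.
  have [->|nik] := eqVneq i k; have [->|njk] := eqVneq j k.
  + rewrite -[RHS](yy x); apply: eq_bigr => l _.
    by rewrite [Q' x l k]mxE eqxx.
  + rewrite -[RHS](oy x j); last by rewrite ltn_neqAle jk andbT.
    by apply: eq_bigr => l _; rewrite ![Q' x l _]mxE eqxx (negbTE njk) mulrC.
  + rewrite ?(negbTE nik) -[RHS](oy x i); last first.
      by rewrite ltn_neqAle ik andbT.
    by apply: eq_bigr => l _; rewrite ![Q' x l _]mxE eqxx (negbTE nik).
  + rewrite -(oQ x i j); rewrite ?ltn_neqAle ?ik ?jk ?andbT //.
    rewrite mxE; apply: eq_bigr => l _.
    by rewrite !mxE ?(negbTE nik) ?(negbTE njk).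
Qed.

(** Constant families give the existence of the factorization; continuity is
    for the deflation path. *)
Lemma continuous_QR A : continuous A -> (forall x, A x \in unitmx) ->
  exists Q U : X -> 'M[R]_N,
  [/\ continuous Q, forall x, A x = Q x *m U x,
      forall x, (Q x)^T *m Q x = 1%:M &
      forall x, upper (U x) /\ forall j, 0 < U x j j].
Proof.
move=> cA uA.
have H k : (k <= N)%N -> exists Q U : X -> 'M[R]_N,
  [/\ continuous Q, forall x, A x = Q x *m U x,
      forall x, upper (U x) /\ forall j, 0 < U x j j &
      forall x (i j : 'I_N), (i < k)%N -> (j < k)%N ->
        ((Q x)^T *m Q x) i j = (i == j)%:R].
  elim: k => [|k IH] kN.
    exists A, (fun=> 1%:M); split=> // x; first by rewrite mulmx1.
    split=> [i j ji|j]; rewrite mxE ?eqxx ?ltr01 //.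
    by rewrite -val_eqE gtn_eqF.
  have [Q [U [cQ AQU hU oQ]]] := IH (ltnW kN).
  have uQ x : Q x \in unitmx.
    by have := uA x; rewrite AQU unitmx_mul => /andP[].
  have [Q' [S [cQ' QQS hS oQ']]] := @gram_schmidt_step (Ordinal kN) Q cQ uQ oQ.
  exists Q', (fun x => S x *m U x); split=> // x.
    by rewrite mulmxA -QQS.
  have [[uU dU] [uS dS]] := (hU x, hS x).
  split; first exact: upper_mul.
  by move=> j; rewrite upper_mul_diag // mulr_gt0.
have [Q [U [cQ AQU hU oQ]]] := H N (leqnn N).
exists Q, U; split=> // x; apply/matrixP => i j.
by rewrite oQ ?ltn_ord // [RHS]mxE.
Qed.

End GramSchmidt.

(** * Cholesky factors near the identity; almost invertible matrices *)

Section Cholesky.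
Context {R : realType} {N : nat}.
Implicit Types U E W : 'M[R]_N.

Lemma sum_sqr_form (E : 'M[R]_N) (e : R) (y : 'I_N -> R) :
  (forall i j, `|E i j| <= e) ->
  \sum_i \sum_j y i * E i j * y j <= N%:R * e * \sum_i y i ^+ 2.
Proof.
move=> hE.
apply: (@le_trans _ _ (\sum_i \sum_(j < N) e / 2 * (y i ^+ 2 + y j ^+ 2))).
  apply: ler_sum => i _; apply: ler_sum => j _.
  have e0 : 0 <= e := le_trans (normr_ge0 _) (hE i j).
  apply: le_trans (ler_norm _) _; rewrite !normrM.
  apply: (@le_trans _ _ (`|y i| * e * `|y j|)).
    by rewrite ler_wpM2r // ler_wpM2l.
  rewrite -[y i ^+ 2]real_normK ?num_real // -[y j ^+ 2]real_normK ?num_real //.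
  have := sqr_ge0 (`|y i| - `|y j|); nra.
under eq_bigr do rewrite -mulr_sumr big_split /= sumr_const card_ord.
rewrite -mulr_sumr big_split /= sumr_const card_ord.
under eq_bigr do rewrite -[_ *+ N]mulr_natl.
by rewrite -mulr_sumr -[_ *+ N]mulr_natl; lra.
Qed.

(** The equation reads U^T - U^-1 = - E U^-1, and U^T and U^-1 are lower and
    upper triangular: the strictly lower part of the right-hand side is that of
    U^T, and its diagonal bounds U - 1 there because |u - 1| <= |u - 1/u|. The
    columns of U^-1 have length at most sqrt 2 as U^T U is at least 1/2. *)
Lemma cholesky_near_identity U E (e : R) :
  upper U -> (forall j, 0 < U j j) -> U^T *m U = 1%:M - E ->
  (forall i j, `|E i j| <= e) -> N%:R * e <= 2^-1 ->
  forall i j, `|U i j - (i == j)%:R| <= 2 * N%:R * e.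
Proof.
move=> hU dU UU hE Ne.
have dU0 j : U j j != 0 by rewrite gt_eqF.
have uU := upper_unit hU dU0.
have [hW dW] := upper_inv hU dU0; set W := invmx U in hW dW.
have W2 j : \sum_k W k j ^+ 2 <= 2.
  have : (W^T *m (U^T *m U) *m W) j j = 1.
    by rewrite mulmxA -trmx_mul mulmxV // trmx1 mul1mx mulmxV // mxE eqxx.
  rewrite UU mulmxBr mulmx1 mulmxBl 3!mxE.
  have -> : \sum_k W^T j k * W k j = \sum_k W k j ^+ 2.
    by apply: eq_bigr => k _; rewrite mxE expr2.
  have -> : (W^T *m E *m W) j j = \sum_k \sum_l W k j * E k l * W l j.
    rewrite mxE exchange_big /=; apply: eq_bigr => l _.
    by rewrite mxE mulr_suml; apply: eq_bigr => k _; rewrite mxE.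
  have := sum_sqr_form (fun k => W k j) hE.
  have S0 : 0 <= \sum_k W k j ^+ 2 by apply: sumr_ge0 => k _; exact: sqr_ge0.
  set S := \sum_k W k j ^+ 2 in S0 *; set F := \sum_k \sum_l _.
  by move=> h1 h2; have := ler_wpM2r S0 Ne; lra.
have Wle k j : `|W k j| <= 2.
  rewrite -(@ler_pXn2r _ 2%N) ?nnegrE // real_normK ?num_real //.
  apply: le_trans (_ : 2 <= _); last by lra.
  apply: le_trans (W2 j); rewrite (bigD1 k) //= lerDl.
  by apply: sumr_ge0 => l _; exact: sqr_ge0.
have EW i j : `|(E *m W) i j| <= 2 * N%:R * e.
  rewrite mxE; apply: le_trans (ler_norm_sum _ _ _) _.
  apply: (@le_trans _ _ (\sum_(k < N) e * 2)).
    by apply: ler_sum => k _; rewrite normrM ler_pM.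
  by rewrite sumr_const card_ord -[_ *+ N]mulr_natl; lra.
have UW : U^T - W = - (E *m W).
  have : (U^T *m U) *m W = W - E *m W by rewrite UU mulmxBl mul1mx.
  by rewrite -mulmxA mulmxV // mulmx1 => ->; rewrite addrAC subrr add0r.
have UWE i j : `|U j i - W i j| <= 2 * N%:R * e.
  have -> : U j i - W i j = - (E *m W) i j.
    by have := congr1 (fun M : 'M[R]_N => M i j) UW; rewrite !mxE.
  by rewrite normrN.
move=> i j; have [<-|ij] := eqVneq i j; last first.
  have [lij|lji] := ltnP i j; first by have := UWE j i; rewrite hW.
  rewrite hU ?subrr ?normr0 ?(le_trans (normr_ge0 _) (EW i j)) //.
  by rewrite ltn_neqAle lji andbT eq_sym.
apply: le_trans (UWE i i); rewrite dW.
have u0 := dU i; set u := U i i in u0 *.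
have -> : u - u^-1 = (u - 1) * ((u + 1) / u) by field; rewrite gt_eqF.
rewrite normrM ler_peMr // ger0_norm; last by rewrite divr_ge0 //; lra.
by rewrite ler_pdivlMr //; lra.
Qed.

End Cholesky.

Section AlmostInvertible.
Context {R : realType} {n : nat}.
Implicit Types M Q U : 'M[R]_n.+2.
Implicit Types w x : 'cV[R]_n.+2.

(** The form in which almost invertibility is proved and used. *)
Definition injective_off_last M :=
  forall x, x ord_max 0 = 0 -> M *m x = 0 -> x = 0.

Lemma almost_invertible_inj M : injective_off_last M -> almost_invertible M.
Proof.
move=> hM; apply: inj_row_free => v vM.
pose x : 'cV[R]_n.+2 :=
  \col_i (if unlift ord_max i is Some j then v 0 j else 0).
have /hM : x ord_max 0 = 0 by rewrite mxE unlift_none.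
have xl j : x (lift ord_max j) 0 = v 0 j by rewrite mxE liftK.
move=> h; suff /h x0 : M *m x = 0.
  by apply/rowP => j; rewrite -xl x0 !mxE.
apply/colP => i.
rewrite mxE (bigD1_ord ord_max) //= mxE unlift_none mulr0 add0r.
move/rowP/(_ i): vM; rewrite !mxE => vM; rewrite -[RHS]vM.
by apply: eq_bigr => j _; rewrite xl !mxE mulrC.
Qed.

Definition set_last_col M w : 'M[R]_n.+2 :=
  \matrix_(i, j) if j == ord_max then w i 0 else M i j.

(** The first columns are independent and w is orthogonal to them. This turns
    an almost invertible matrix into an invertible one without changing its
    first columns, hence without changing those of Q. *)
Lemma set_last_col_unit M w : injective_off_last M -> w != 0 ->
  (forall j, j != ord_max -> (w^T *m M) 0 j = 0) ->
  set_last_col M w \in unitmx.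
Proof.
move=> hM w0 wM; rewrite -unitmx_tr -row_free_unit; apply: inj_row_free => v vA.
pose x := v^T.
have {vA} Ax : set_last_col M w *m x = 0.
  by rewrite -[LHS]trmxK trmx_mul trmxK vA trmx0.
pose x' : 'cV[R]_n.+2 := \col_i (if i == ord_max then 0 else x i 0).
have E : set_last_col M w *m x = M *m x' + x ord_max 0 *: w.
  apply/colP => i; rewrite !mxE (bigD1 ord_max) //= [in RHS](bigD1 ord_max) //=.
  rewrite !mxE eqxx mulr0 add0r addrC mulrC; congr (_ + _).
  by apply: eq_bigr => j /negbTE jm; rewrite !mxE jm.
have wMx : (w^T *m (M *m x')) 0 0 = 0.
  rewrite mulmxA mxE big1 // => j _.
  have [->|jm] := eqVneq j ord_max; first by rewrite [x' _ _]mxE eqxx mulr0.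
  by rewrite wM // mul0r.
have ww : 0 < (w^T *m w) 0 0.
  rewrite mxE; have := dot_gt0 w0; congr (_ < _); apply: eq_bigr => i _.
  by rewrite mxE expr2.
have xN : x ord_max 0 = 0.
  have := congr1 (fun z => (w^T *m z) 0 0) Ax.
  rewrite E mulmxDr mxE wMx add0r -scalemxAr mulmx0 mxE [RHS]mxE => /eqP.
  by rewrite mulf_eq0 (gt_eqF ww) orbF => /eqP.
have xx' : x = x'.
  by apply/colP => i; rewrite [RHS]mxE; case: eqP => // ->.
have x0 : x = 0.
  by apply: hM => //; move: Ax; rewrite E xN scale0r addr0 -xx'.
by rewrite -(trmxK v) -/x x0 trmx0.
Qed.

Lemma exists_normal M : exists2 w : 'cV[R]_n.+2, w != 0 &
  forall j, j != ord_max -> (w^T *m M) 0 j = 0.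
Proof.
have : kermx (col' ord_max M) != 0.
  rewrite -mxrank_eq0 mxrank_ker subn_eq0 -ltnNge ltnS.
  exact: rank_leq_col.
case/rowV0Pn => v /sub_kermxP vM v0; exists v^T.
  by rewrite -trmx0 (inj_eq trmx_inj).
move=> j jm; rewrite trmxK.
have [k kj] : exists k, j = lift ord_max k.
  by case: (unliftP ord_max j) jm => [k ->|->]; [exists k|rewrite eqxx].
move/rowP/(_ k): vM; rewrite !mxE => vM; rewrite -[RHS]vM kj.
by apply: eq_bigr => i _; rewrite mxE.
Qed.

(** The first columns of Q span the same space as those of A, and w is
    orthogonal to this space. *)
Lemma last_col_normal A Q U w : A = Q *m U -> Q^T *m Q = 1%:M ->
  upper U -> (forall j, 0 < U j j) -> (forall i, A i ord_max = w i 0) ->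
  (forall j, j != ord_max -> (w^T *m A) 0 j = 0) ->
  w = U ord_max ord_max *: col ord_max Q.
Proof.
move=> AQU QQ hU dU Aw wA.
have dU0 j : U j j != 0 by rewrite gt_eqF.
have uU := upper_unit hU dU0.
have [hW dW] := upper_inv hU dU0.
have wE : w = Q *m col ord_max U.
  by apply/colP => i; rewrite -Aw AQU !mxE; apply: eq_bigr => k _; rewrite mxE.
have wQ : w^T *m Q = w^T *m A *m invmx U by rewrite AQU mulmxA mulmxK.
have z0 k : k != ord_max -> U k ord_max = 0.
  move=> km; have -> : U k ord_max = (w^T *m Q) 0 k.
    by rewrite wE trmx_mul -mulmxA QQ mulmx1 !mxE.
  rewrite wQ mxE big1 // => j _.
  have [->|jm] := eqVneq j ord_max; last by rewrite wA // mul0r.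
  by rewrite hW ?mulr0 // ltn_neqAle -ltnS ltn_ord andbT; exact: km.
apply/colP => i; rewrite wE !mxE (bigD1 ord_max) //= big1 => [|k km].
  by rewrite !mxE addr0 mulrC.
by rewrite !mxE z0 // mulr0.
Qed.

(** The first columns of M determine Q up to the sign of its last column,
    which the determinant fixes. *)
Lemma QRstar_exists M : injective_off_last M -> exists Q U, QRstar M Q U.
Proof.
move=> hM; have [w w0 wM] := exists_normal M.
have uA := set_last_col_unit hM w0 wM; set A := set_last_col M w in uA.
have cA : continuous (fun _ : R => A) by move=> x; exact: cvg_cst.
have [Q' [U' [_ AQU QQ hU]]] := continuous_QR cA (fun=> uA).
move: (Q' 0) (U' 0) (AQU 0) (QQ 0) (hU 0) => {hU QQ AQU}Q {U'}U AQU QQ [hU dU].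
pose d := \det Q.
have dd : d * d = 1 by rewrite /d -{1}det_tr -det_mulmx QQ det1.
(* det Q is 1 or -1: scaling the last column by it makes the determinant 1 *)
pose D : 'rV[R]_n.+2 := \row_j (if j == ord_max then d else 1).
have DD : diag_mx D *m diag_mx D = 1%:M.
  rewrite mulmx_diag; apply/matrixP => i j; rewrite !mxE.
  by case: ifP => _; rewrite ?dd ?mulr1.
have detD : \det (diag_mx D) = d.
  rewrite det_diag (bigD1 ord_max) //= big1 ?mulr1 => [|i /negbTE im].
    by rewrite mxE eqxx.
  by rewrite mxE im.
have QQ' : Q *m Q^T = 1%:M by apply: mulmx1C.
pose Q1 := Q *m diag_mx D.
have Q1Q1 : Q1^T *m Q1 = 1%:M.
  by rewrite trmx_mul tr_diag_mx mulmxA -(mulmxA _ Q^T) QQ mulmx1 DD.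
have MA j : j != ord_max -> forall i, (Q1^T *m M) i j = D 0 i * U i j.
  move=> jm i; have -> : (Q1^T *m M) i j = (Q1^T *m A) i j.
    rewrite !mxE; apply: eq_bigr => k _; congr (_ * _).
    by rewrite mxE (negbTE jm).
  rewrite AQU trmx_mul tr_diag_mx mulmxA -(mulmxA _ Q^T) QQ mulmx1.
  by rewrite mul_diag_mx mxE.
exists Q1, (Q1^T *m M); split.
- by rewrite mulmxA (mulmx1C Q1Q1) mul1mx.
- by rewrite det_mulmx detD -/d dd.
- move=> i j ji; have jm : j != ord_max.
    by rewrite -val_eqE /= neq_ltn (leq_trans ji) // -ltnS ltn_ord.
  by rewrite MA // hU // mulr0.
- move=> j jm; rewrite MA // mulr_gt0 // mxE (negbTE jm) //.
Qed.

Lemma Qstar_spec M : injective_off_last M -> exists U, QRstar M (Qstar M) U.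
Proof.
move=> /QRstar_exists [Q [U h]].
by apply: (@xgetPex _ 1%:M [set Q | exists U, QRstar M Q U]); exists Q, U.
Qed.

End AlmostInvertible.

(** * Spectral measure of the last basis vector *)

Section Isospectral.
Context {R : realType} {n : nat}.
Variable lam : 'I_n.+2 -> R.
Implicit Types M Q U V T : 'M[R]_n.+2.

Definition eigenbasis T V : Prop :=
  V *m V^T = 1%:M /\ V *m T = diag_mx (\row_j lam j) *m V.

Lemma eigenbasis_exists T : injective lam -> T^T = T ->
  (forall i, eigenvalue T (lam i)) -> exists V, eigenbasis T V.
Proof.
move=> lam_inj Tsym hev.
have H i : exists v : 'rV[R]_n.+2, v *m T = lam i *: v /\ (v *m v^T) 0 0 = 1.
  have /eigenvalueP [v vT v0] := hev i.
  have vv : 0 < (v *m v^T) 0 0.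
    have v0' : v^T != 0 by rewrite -trmx0 (inj_eq trmx_inj).
    rewrite mxE; have := dot_gt0 v0'; congr (_ < _); apply: eq_bigr => k _.
    by rewrite mxE expr2.
  exists ((Num.sqrt ((v *m v^T) 0 0))^-1 *: v); split.
    by rewrite -scalemxAl vT !scalerA mulrC.
  rewrite linearZ /= -scalemxAl -scalemxAr !mxE.
  move: vv; rewrite mxE; set q := \sum_j _ => q0.
  rewrite mulrA -expr2 exprVn sqr_sqrtr ?mulVf ?gt_eqF //; exact: ltW.
have [f hf] := choice H.
exists (\matrix_i f i); split.
  apply/matrixP => i j.
  have -> : ((\matrix_i f i) *m (\matrix_i f i)^T) i j = (f i *m (f j)^T) 0 0.
    by rewrite !mxE; apply: eq_bigr => k _; rewrite !mxE.
  rewrite [RHS]mxE; have [<-|ij] := eqVneq i j; first by rewrite (hf i).2.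
  have : lam i * (f i *m (f j)^T) 0 0 = lam j * (f i *m (f j)^T) 0 0.
    have <- : (f i *m T *m (f j)^T) 0 0 = lam i * (f i *m (f j)^T) 0 0.
      by rewrite (hf i).1 -scalemxAl mxE.
    have -> : f i *m T *m (f j)^T = f i *m (f j *m T)^T.
      by rewrite trmx_mul Tsym mulmxA.
    by rewrite (hf j).1 linearZ /= -scalemxAr mxE.
  move/eqP; rewrite -subr_eq0 -mulrBl mulf_eq0 subr_eq0.
  move=> /orP[/eqP/lam_inj e|/eqP //].
  by rewrite e eqxx in ij.
apply/row_matrixP => i; rewrite row_mul rowK (hf i).1.
by apply/rowP => j; rewrite mul_diag_mx !mxE.
Qed.

Lemma eigenbasis_conj T V Q : eigenbasis T V -> Q^T *m Q = 1%:M ->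
  eigenbasis (Q^T *m T *m Q) (V *m Q).
Proof.
move=> [VV VT] QQ; have QQ' := mulmx1C QQ; split.
  by rewrite trmx_mul mulmxA -(mulmxA V) QQ' mulmx1.
by rewrite !mulmxA -(mulmxA V) QQ' mulmx1 VT.
Qed.

Lemma eigenvalue_conj T Q a : Q^T *m Q = 1%:M ->
  eigenvalue T a -> eigenvalue (Q^T *m T *m Q) a.
Proof.
move=> QQ /eigenvalueP [v vT v0]; have QQ' := mulmx1C QQ.
apply/eigenvalueP; exists (v *m Q).
  by rewrite !mulmxA -(mulmxA v) QQ' mulmx1 vT scalemxAl.
apply: contra v0 => /eqP /(congr1 (fun w => w *m Q^T)).
by rewrite -mulmxA QQ' mulmx1 mul0mx => ->.
Qed.

Lemma TLambda_conj T Q : TLambda lam T -> Q^T *m Q = 1%:M ->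
  tridiagonal (Q^T *m T *m Q) -> TLambda lam (Q^T *m T *m Q).
Proof.
move=> [Tsym _ spT] QQ tF; split=> //.
  by rewrite !trmx_mul trmxK Tsym mulmxA.
rewrite -spT; apply/seteqP; split=> x /=; last exact: eigenvalue_conj.
have QQ' : Q^T^T *m Q^T = 1%:M by rewrite trmxK mulmx1C.
move/(eigenvalue_conj QQ'); rewrite trmxK !mulmxA.
by rewrite (mulmx1C QQ) mul1mx -!mulmxA (mulmx1C QQ) mulmx1.
Qed.

(** With F = Q^T T Q, commutation gives F U = U T, which is upper Hessenberg.
    The leading block of U is invertible, so F is upper Hessenberg too (its last
    column is not constrained), and F is symmetric. *)
Lemma tridiagonal_conj T M Q U : T^T = T -> tridiagonal T ->
  T *m M = M *m T -> M = Q *m U -> Q^T *m Q = 1%:M -> upper U ->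
  (forall j, j != ord_max -> U j j != 0) -> tridiagonal (Q^T *m T *m Q).
Proof.
move=> Tsym tT TM MQU QQ hU dU; set F := Q^T *m T *m Q.
have FU : F *m U = U *m T.
  by rewrite /F -mulmxA -MQU -mulmxA TM MQU -mulmxA mulmxA QQ mul1mx.
have Fsym i j : F i j = F j i.
  have FT : F^T = F by rewrite /F !trmx_mul trmxK Tsym mulmxA.
  by rewrite -{1}FT mxE.
suff H m (k l : 'I_n.+2) : (l < m)%N -> (l.+1 < k)%N -> F k l = 0.
  move=> i j /orP[]; last by apply: (H n.+2); exact: ltn_ord.
  by rewrite Fsym; apply: (H n.+2); exact: ltn_ord.
elim: m k l => // m IH k l lm lk.
have lmax : l != ord_max.
  by rewrite -val_eqE /= neq_ltn -ltnS (leq_trans lk) // ltnW ?ltn_ord.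
have E : (F *m U) k l = (U *m T) k l by rewrite FU.
rewrite [LHS]mxE [RHS]mxE in E; move: E.
rewrite (bigD1 l) //= big1 => [|j jl]; last first.
  have [ljl|llj] := ltnP j l.
    by rewrite IH ?mul0r //; lia.
  by rewrite hU ?mulr0 // ltn_neqAle llj eq_sym jl.
rewrite big1 => [|j _].
  by rewrite addr0 => /eqP; rewrite mulf_eq0 (negbTE (dU l lmax)) orbF => /eqP.
have [jk|kj] := ltnP j k; first by rewrite hU ?mul0r.
by rewrite tT ?mulr0 // (leq_trans lk) ?orbT.
Qed.

(** The mass at lam j of the spectral measure of the last basis vector. *)
Definition weight V j := V j ord_max ^+ 2.

Lemma weight_ge0 V j : 0 <= weight V j. Proof. exact: sqr_ge0. Qed.

Lemma weight_sum V : V *m V^T = 1%:M -> \sum_j weight V j = 1.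
Proof.
move/mulmx1C/(congr1 (fun A : 'M[R]_n.+2 => A ord_max ord_max)).
rewrite !mxE eqxx => h; apply: etrans h; apply: eq_bigr => j _.
by rewrite mxE /weight expr2.
Qed.

Lemma weight_off V i : V *m V^T = 1%:M ->
  \sum_(j | j != i) weight V j = 1 - weight V i.
Proof. by move/weight_sum; rewrite (bigD1 i) //= => h; lra. Qed.

Lemma tridiagonal_last_row T l : tridiagonal T -> l != ord_max ->
  T ord_max l = bot T * (l == inord n)%:R.
Proof.
move=> tT lm; have [->|ln] := eqVneq l (inord n); first by rewrite mulr1.
rewrite mulr0; apply: tT; move: ln lm; rewrite -!val_eqE /= inordK // => ln lm.
have := ltn_ord l; lia.
Qed.

Lemma last_row_sqr T z : tridiagonal T ->
  \sum_k (T - z%:M) ord_max k ^+ 2 = bot T ^+ 2 + (T ord_max ord_max - z) ^+ 2.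
Proof.
move=> tT; rewrite (bigD1 ord_max) //= (bigD1 (inord n)) /=; last first.
  by rewrite -val_eqE /= inordK // neq_ltn ltnSn.
rewrite big1 => [|k /andP[km kn]].
  rewrite !mxE eqxx addr0 addrC (_ : (ord_max == inord n) = false).
    by rewrite mulr0n subr0 mulr1n.
  by rewrite -val_eqE /= inordK // gtn_eqF.
rewrite !mxE eq_sym (negbTE km) subr0 tridiagonal_last_row //.
by rewrite (negbTE kn) mulr0 expr0n.
Qed.

(** Both sides are the squared length of the last row of T - z, computed in
    the eigenbasis and in the standard basis. *)
Lemma weight_moment T V z : T^T = T -> tridiagonal T -> eigenbasis T V ->
  \sum_j weight V j * (lam j - z) ^+ 2 =
  bot T ^+ 2 + (T ord_max ord_max - z) ^+ 2.
Proof.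
move=> Tsym tT [VV VT]; rewrite -last_row_sqr //.
pose D := diag_mx (\row_j (lam j - z)).
have VTz : V *m (T - z%:M) = D *m V.
  rewrite mulmxBr VT mul_mx_scalar; rewrite /D !mul_diag_mx; apply/matrixP => i j.
  by rewrite !mxE mulrBl.
have Tzs : (T - z%:M)^T = T - z%:M by rewrite linearB /= Tsym tr_scalar_mx.
have <- : ((T - z%:M) *m (T - z%:M)^T) ord_max ord_max
    = \sum_k (T - z%:M) ord_max k ^+ 2.
  rewrite mxE; apply: eq_bigr => k _; by rewrite [_^T k _]mxE expr2.
have -> : (T - z%:M) *m (T - z%:M)^T = (D *m V)^T *m (D *m V).
  by rewrite -VTz trmx_mul mulmxA -(mulmxA _ V^T) (mulmx1C VV) mulmx1 Tzs.
rewrite mxE; apply: eq_bigr => j _; rewrite mxE mul_diag_mx !mxE /weight; ring.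
Qed.

(** Compares weight_moment at z = 0 and at z = 1. *)
Lemma weight_mean T V : T^T = T -> tridiagonal T -> eigenbasis T V ->
  \sum_j weight V j * lam j = T ord_max ord_max.
Proof.
move=> Tsym tT hV; have VV := hV.1.
have h0 := weight_moment 0 Tsym tT hV; have h1 := weight_moment 1 Tsym tT hV.
have : \sum_j weight V j * (lam j - 1) ^+ 2 =
  \sum_j weight V j * (lam j - 0) ^+ 2 - 2 * (\sum_j weight V j * lam j)
  + \sum_j weight V j.
  rewrite mulr_sumr -sumrB -big_split /=; apply: eq_bigr => j _; ring.
by rewrite h0 h1 weight_sum //; lra.
Qed.

Lemma weight_concentration V i z h : V *m V^T = 1%:M -> 0 <= h ->
  (forall j, j != i -> h <= `|lam j - z|) ->
  (1 - weight V i) * h ^+ 2 <= \sum_j weight V j * (lam j - z) ^+ 2.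
Proof.
move=> VV h0 hz; rewrite -weight_off // mulr_suml [leRHS](bigD1 i) //=.
rewrite -[leLHS]add0r lerD //; first by rewrite mulr_ge0 ?weight_ge0 ?sqr_ge0.
apply: ler_sum => j ji; rewrite ler_wpM2l ?weight_ge0 //.
by rewrite -[leRHS]real_normK ?num_real // lerXn2r ?nnegrE // hz.
Qed.

(** A variance cannot be less than every squared distance to the mean. *)
Lemma nearest_eigenvalue T V : T^T = T -> tridiagonal T -> eigenbasis T V ->
  exists i, `|lam i - T ord_max ord_max| <= `|bot T|.
Proof.
move=> Tsym tT hV; apply: contrapT => hn.
have h j : bot T ^+ 2 < (lam j - T ord_max ord_max) ^+ 2.
  rewrite -(real_normK (num_real (bot T))).
  rewrite -(real_normK (num_real (lam j - _))) ltrXn2r ?nnegrE //.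
  by rewrite ltNge; apply/negP => hj; apply: hn; exists j.
have := weight_moment (T ord_max ord_max) Tsym tT hV.
rewrite subrr expr0n addr0 => E.
have : \sum_j weight V j * ((lam j - T ord_max ord_max) ^+ 2 - bot T ^+ 2) = 0.
  under eq_bigr do rewrite mulrBr.
  by rewrite sumrB E -mulr_suml weight_sum ?mul1r ?subrr //; exact: hV.1.
have hp j : true ->
    0 <= weight V j * ((lam j - T ord_max ord_max) ^+ 2 - bot T ^+ 2).
  by rewrite mulr_ge0 ?weight_ge0 // subr_ge0 ltW.
move=> /(psumr_eq0P hp) h0.
have := weight_sum hV.1; rewrite big1 => [/eqP|j _].
  by rewrite eq_sym oner_eq0.
have /eqP := h0 j isT; rewrite mulf_eq0 [X in _ || X]gt_eqF ?subr_gt0 // orbF.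
by move/eqP.
Qed.

Lemma eigenvector_off_last V i (x : 'cV[R]_n.+2) : V *m V^T = 1%:M ->
  V i ord_max != 0 -> (forall j, j != i -> (V *m x) j 0 = 0) ->
  x ord_max 0 = 0 -> x = 0.
Proof.
move=> VV Vi hj xN.
have xE : x = V^T *m (V *m x) by rewrite mulmxA (mulmx1C VV) mul1mx.
suff V0 : V *m x = 0 by rewrite xE V0 mulmx0.
apply/colP => j; rewrite [RHS]mxE.
have [->|/hj //] := eqVneq j i.
have : (V^T *m (V *m x)) ord_max 0 = 0 by rewrite -xE.
rewrite mxE (bigD1 i) //= big1 => [|k ki]; last by rewrite hj ?mulr0.
by rewrite addr0 [_^T _ _]mxE => /eqP; rewrite mulf_eq0 (negbTE Vi) /= => /eqP.
Qed.

Lemma shift_injective_off_last T V i s : eigenbasis T V ->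
  V i ord_max != 0 -> (forall j, j != i -> lam j != s) ->
  injective_off_last (T - s%:M).
Proof.
move=> [VV VT] Vi hs x xN Mx; apply: (eigenvector_off_last VV Vi) => // j ji.
have := congr1 (fun y => (V *m y) j 0) Mx.
rewrite mulmxA mulmxBr VT mul_mx_scalar mulmx0 mulmxBl -scalemxAl -mulmxA.
rewrite mul_diag_mx.
rewrite ![in LHS]mxE [in RHS]mxE => /eqP.
rewrite -mulrBl mulf_eq0 subr_eq0 (negbTE (hs j ji)) /= => /eqP <-.
by rewrite mxE.
Qed.

(** As T - s = U^T Q^T, the last column q of Q satisfies (T - s) q = r e, with e
    the last basis vector and r the last diagonal entry of U; this is that
    identity in eigencoordinates. *)
Lemma shifted_weights T V s Q U j : T^T = T -> eigenbasis T V ->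
  QRstar (T - s%:M) Q U ->
  (lam j - s) * (V *m Q) j ord_max = U ord_max ord_max * V j ord_max.
Proof.
move=> Tsym [VV VT] [MQU [QQ _] hU _].
have MQ : (T - s%:M) *m Q = U^T.
  have -> : T - s%:M = U^T *m Q^T.
    by rewrite -trmx_mul -MQU linearB /= Tsym tr_scalar_mx.
  by rewrite -mulmxA QQ mulmx1.
have -> : (lam j - s) * (V *m Q) j ord_max =
    (diag_mx (\row_j lam j) *m (V *m Q) - s *: (V *m Q)) j ord_max.
  by rewrite mul_diag_mx !mxE mulrBl.
have -> : diag_mx (\row_j lam j) *m (V *m Q) - s *: (V *m Q) = V *m U^T.
  by rewrite -MQ !mulmxA mulmxBr VT mul_mx_scalar mulmxBl -scalemxAl -mulmxA.
rewrite mxE (bigD1 ord_max) //= big1 ?addr0 => [|k km].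
  by rewrite mxE mulrC.
rewrite mxE hU ?mulr0 // ltn_neqAle -ltnS ltn_ord andbT.
by move: km; rewrite -val_eqE.
Qed.

(** From shifted_weights at i and at j, the new coordinate at j is the old one
    times (lam i - s) / (lam j - s), up to the bounded ratio of the new and old
    coordinates at i; and lam j - s is comparable to lam j - lam i. *)
Lemma shifted_moment T V s Q U i g : T^T = T -> eigenbasis T V ->
  QRstar (T - s%:M) Q U -> 0 < g ->
  (forall j, j != i -> g <= `|lam j - lam i|) ->
  2^-1 <= weight V i -> `|s - lam i| <= g / 4 ->
  \sum_j weight (V *m Q) j * (lam j - lam i) ^+ 2
    <= 8 * (s - lam i) ^+ 2 * (1 - weight V i).
Proof.
move=> Tsym hV hQ g0 hg wi hs; have VV := hV.1.
have [_ [QQ _] _ _] := hQ.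
have VV' := (eigenbasis_conj hV QQ).1.
rewrite -weight_off // (bigD1 i) //= subrr expr0n mulr0 add0r mulr_sumr.
apply: ler_sum => j ji.
have ei := shifted_weights i Tsym hV hQ; have ej := shifted_weights j Tsym hV hQ.
have bi : weight (V *m Q) i <= 1.
  rewrite -(weight_sum VV') [leRHS](bigD1 i) //= lerDl.
  by apply: sumr_ge0 => k _; exact: weight_ge0.
rewrite /weight in wi bi *.
set r := U _ _ in ei ej; set ai := V i _ in ei wi; set aj := V j _ in ej *.
set be := (V *m Q) i _ in ei bi; set bj := (V *m Q) j _ in ej *.
have hj := hg j ji.
have d4 : (lam j - lam i) ^+ 2 <= 4 * (lam j - s) ^+ 2.
  have h : `|lam j - lam i| <= 2 * `|lam j - s|.
    have := ler_normD (lam j - s) (s - lam i); rewrite addrA subrK => h.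
    lra.
  have := lerXn2r 2 (normr_ge0 _) (le_trans (normr_ge0 _) h) h.
  by rewrite exprMn !real_normK ?num_real //; lra.
have E : ai ^+ 2 * (bj ^+ 2 * (lam j - s) ^+ 2) =
         aj ^+ 2 * ((s - lam i) ^+ 2 * be ^+ 2).
  have -> : ai ^+ 2 * (bj ^+ 2 * (lam j - s) ^+ 2) =
    (ai * ((lam j - s) * bj)) ^+ 2 by ring.
  rewrite ej mulrCA -/r mulrA -ei; ring.
have p1 : 0 <= bj ^+ 2 by rewrite sqr_ge0.
have p2 : 0 <= bj ^+ 2 * (lam j - s) ^+ 2 by rewrite mulr_ge0 ?sqr_ge0.
have p3 : 0 <= aj ^+ 2 * (s - lam i) ^+ 2 by rewrite mulr_ge0 ?sqr_ge0.
have h1 : 2^-1 * (bj ^+ 2 * (lam j - s) ^+ 2) <= aj ^+ 2 * (s - lam i) ^+ 2.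
  apply: le_trans (ler_wpM2r p2 wi) _.
  by rewrite E mulrA -[leRHS]mulr1 ler_wpM2l.
have := ler_wpM2l p1 d4; lra.
Qed.

End Isospectral.

(** * The deflation path and the components of deflation neighborhoods *)

Section DeflationPath.
Context {R : realType} {n : nat}.
Variable lam : 'I_n.+2 -> R.
Implicit Types M V T : 'M[R]_n.+2.

Definition eigenprojection V i : 'M[R]_n.+2 := (row i V)^T *m row i V.

(** Fixes the other eigenvectors and multiplies the i-th one by 1 - t. *)
Definition damping V i (t : R) : 'M[R]_n.+2 := 1%:M - t *: eigenprojection V i.

(** A normal to all columns of damping V i t but the last, chosen continuous
    and nonzero for all t; it moves from the last basis vector to a multiple of
    the eigenvector. *)
Definition damping_normal V i (t : R) : 'cV[R]_n.+2 :=
  (1 - t) *: delta_mx ord_max 0 + (t * V i ord_max) *: (row i V)^T.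

Lemma mul_eigenrow V i : V *m V^T = 1%:M -> V *m (row i V)^T = delta_mx i 0.
Proof. by move=> VV; rewrite tr_row colE mulmxA VV mul1mx. Qed.

Lemma eigenrow_unit V i : V *m V^T = 1%:M ->
  row i V *m (row i V)^T = 1%:M.
Proof.
move=> VV; rewrite {1}rowE -mulmxA mul_eigenrow // mul_delta_mx.
by apply/matrixP => a b; rewrite !ord1 !mxE !eqxx.
Qed.

Lemma damping_injective V i t : V *m V^T = 1%:M -> V i ord_max != 0 ->
  injective_off_last (damping V i t).
Proof.
move=> VV Vi x xN Bx; apply: (eigenvector_off_last VV Vi) => // j ji.
have : (V *m (damping V i t *m x)) j 0 = 0 by rewrite Bx mulmx0 mxE.
rewrite mulmxBl mul1mx mulmxBr -scalemxAl -scalemxAr !mulmxA mul_eigenrow //.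
rewrite -mulmxA [LHS]mxE [X in _ + X]mxE; set z := row i V *m x => E.
have : (t *: (delta_mx i 0 *m z)) j 0 = 0.
  by rewrite mxE mxE big1 ?mulr0 // => k _; rewrite mxE (negbTE ji) mul0r.
by move=> z0; rewrite z0 oppr0 addr0 in E.
Qed.

Lemma damping_normal_mul V i t : V *m V^T = 1%:M ->
  (damping_normal V i t)^T *m damping V i t = (1 - t) *: delta_mx 0 ord_max.
Proof.
move=> VV.
have wv : (damping_normal V i t)^T *m (row i V)^T = (V i ord_max)%:M.
  rewrite -trmx_mul mulmxDr -!scalemxAr eigenrow_unit // -colE.
  by apply/matrixP => a b; rewrite !ord1 !mxE !eqxx /=; ring.
rewrite mulmxBr mulmx1 -scalemxAr mulmxA wv mul_scalar_mx.
rewrite /damping_normal linearD /= !linearZ /=.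
by rewrite trmxK trmx_delta !scalerN scalerA addrK.
Qed.

Lemma mul_damping_normal V i t j : V *m V^T = 1%:M ->
  (V *m damping_normal V i t) j 0 =
  if j == i then V i ord_max else (1 - t) * V j ord_max.
Proof.
move=> VV; rewrite mulmxDr -!scalemxAr mul_eigenrow // -colE !mxE eqxx andbT.
by case: eqP => [->|_] /=; ring.
Qed.

Lemma damping_commute T V i t : T^T = T -> eigenbasis lam T V ->
  T *m damping V i t = damping V i t *m T.
Proof.
move=> Tsym [VV VT].
have vT : row i V *m T = lam i *: row i V.
  by rewrite -row_mul VT; apply/rowP => j; rewrite mul_diag_mx !mxE.
have Tv : T *m (row i V)^T = lam i *: (row i V)^T.
  by rewrite -{1}Tsym -trmx_mul vT linearZ.
rewrite mulmxBr mulmxBl mulmx1 mul1mx -scalemxAr -scalemxAl; congr (_ - _ *: _).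
by rewrite mulmxA Tv -mulmxA vT -scalemxAl -scalemxAr.
Qed.

Lemma set_last_col_0 M w i j : j != ord_max -> set_last_col M w i j = M i j.
Proof. by move=> /negbTE jm; rewrite mxE jm. Qed.

(** The QR factorization along the path. The last column of the damping matrix
    is replaced by the normal because damping V i 1 is singular. *)
Record deflation_flow V i (Q U : R -> 'M[R]_n.+2) : Prop := DeflationFlow {
  flow_continuous : continuous Q;
  flow_factor : forall t,
    set_last_col (damping V i t) (damping_normal V i t) = Q t *m U t;
  flow_orthogonal : forall t, (Q t)^T *m Q t = 1%:M;
  flow_upper : forall t, upper (U t);
  flow_pos : forall t j, 0 < U t j j }.

Lemma deflation_flow_exists V i : V *m V^T = 1%:M -> V i ord_max != 0 ->
  exists Q U : R -> 'M[R]_n.+2, deflation_flow V i Q U.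
Proof.
move=> VV Vi.
pose A t := set_last_col (damping V i t) (damping_normal V i t).
have [|t|Q [U [cQ AQU QQ hU]]] := @continuous_QR R R _ A.
- apply/continuous_mxP => a b.
  have c1 : continuous (fun t : R => 1 - t).
    by move=> t; apply: continuousB; [exact: cvg_cst|exact: cvg_id].
  have cM (c : R) : continuous (fun t : R => t * c).
    by move=> t; apply: continuousM; [exact: cvg_id|exact: cvg_cst].
  have [->|bm] := eqVneq b ord_max.
    have -> : (fun t => A t a ord_max) = (fun t => (1 - t) *
        (delta_mx ord_max 0 : 'cV[R]_n.+2) a 0 + t * (V i ord_max * V i a)).
      by apply/funext => s; rewrite !mxE eqxx mulrA.
    move=> t; apply: cvgD; last exact: cM.
    by apply: cvgM; [exact: c1|exact: cvg_cst].
  have -> : (fun t => A t a b) = (fun t => (1%:M : 'M[R]_n.+2) a b -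
      t * eigenprojection V i a b).
    apply/funext => s; rewrite /A set_last_col_0 // mxE.
    by congr (_ + _); rewrite mxE [X in - X]mxE.
  move=> t; apply: cvgB; [exact: cvg_cst|exact: cM].
- apply: set_last_col_unit; first exact: damping_injective.
    apply/eqP => w0; have := mul_damping_normal i t i VV.
    by rewrite w0 mulmx0 mxE eqxx => /eqP; rewrite eq_sym (negbTE Vi).
  by move=> j jm; rewrite damping_normal_mul // !mxE eqxx (negbTE jm) mulr0.
- by exists Q, U; split => // t; have [] := hU t.
Qed.

Section Flow.
Variables (T V : 'M[R]_n.+2) (i : 'I_n.+2) (Q U : R -> 'M[R]_n.+2).
Hypotheses (hT : TLambda lam T) (hV : eigenbasis lam T V).
Hypothesis flow : deflation_flow V i Q U.

Let VV : V *m V^T = 1%:M. Proof. exact: hV.1. Qed.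
Let Tsym : T^T = T. Proof. by case: hT. Qed.
Let tT : tridiagonal T. Proof. by case: hT. Qed.

Definition flow_at t := (Q t)^T *m T *m Q t.

Lemma flow_damping t j : j != ord_max ->
  forall k, ((Q t)^T *m damping V i t) k j = U t k j.
Proof.
move=> jm k.
have -> : U t k j = ((Q t)^T *m (Q t *m U t)) k j.
  by rewrite mulmxA (flow_orthogonal flow) mul1mx.
rewrite -(flow_factor flow) !mxE; apply: eq_bigr => l _.
by rewrite set_last_col_0.
Qed.

Lemma flow_TLambda t : TLambda lam (flow_at t).
Proof.
apply: TLambda_conj => //; first exact: flow_orthogonal flow t.
have QQ := flow_orthogonal flow t.
apply: (@tridiagonal_conj _ _ T (damping V i t) (Q t)
  ((Q t)^T *m damping V i t)) => //.
- exact: damping_commute Tsym hV.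
- by rewrite mulmxA (mulmx1C QQ) mul1mx.
- move=> a b ba; rewrite flow_damping ?(flow_upper flow) //.
  by rewrite -val_eqE /= neq_ltn (leq_trans ba) // -ltnS ltn_ord.
- by move=> j jm; rewrite flow_damping // gt_eqF // (flow_pos flow).
Qed.

Lemma flow_last_col t :
  damping_normal V i t = U t ord_max ord_max *: col ord_max (Q t).
Proof.
apply: (last_col_normal (flow_factor flow t) (flow_orthogonal flow t)
   (flow_upper flow t) (flow_pos flow t)).
- by move=> j; rewrite mxE eqxx.
- move=> j jm; transitivity (((damping_normal V i t)^T *m damping V i t) 0 j).
    by rewrite !mxE; apply: eq_bigr => k _; rewrite set_last_col_0.
  by rewrite damping_normal_mul // !mxE eqxx (negbTE jm) mulr0.
Qed.

Lemma flow_eigenbasis t : eigenbasis lam (flow_at t) (V *m Q t).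
Proof. exact: eigenbasis_conj (flow_orthogonal flow t). Qed.

Lemma flow_coord t j : U t ord_max ord_max * (V *m Q t) j ord_max =
  if j == i then V i ord_max else (1 - t) * V j ord_max.
Proof.
rewrite -mul_damping_normal // flow_last_col -scalemxAr [in RHS]mxE.
congr (_ * _); rewrite !mxE; apply: eq_bigr => k _.
by rewrite [col _ _ _ _]mxE.
Qed.

(** The common factor by which all weights but the i-th are multiplied. *)
Definition flow_ratio t := (1 - t) ^+ 2 / U t ord_max ord_max ^+ 2.

Let U2 t : 0 < U t ord_max ord_max ^+ 2.
Proof. by rewrite exprn_gt0 // (flow_pos flow). Qed.

Lemma flow_weight t j : j != i ->
  weight (V *m Q t) j = flow_ratio t * weight V j.
Proof.
move=> /negbTE ji; have := flow_coord t j; rewrite ji /weight /flow_ratio => h.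
have u0 : U t ord_max ord_max != 0 by rewrite gt_eqF // (flow_pos flow).
have -> : (V *m Q t) j ord_max = (1 - t) * V j ord_max / U t ord_max ord_max.
  by rewrite -h; field.
by field.
Qed.

(** The squared last entry of U is the normalization w_i + (1 - t)^2 (1 - w_i). *)
Lemma flow_ratio_le1 t : 0 <= t <= 1 -> 0 <= flow_ratio t <= 1.
Proof.
move=> /andP[t0 t1]; rewrite /flow_ratio divr_ge0 ?sqr_ge0 //=.
rewrite ler_pdivrMr // mul1r.
have -> : U t ord_max ord_max ^+ 2 =
    weight V i + (1 - t) ^+ 2 * (1 - weight V i).
  have W : \sum_j (U t ord_max ord_max * (V *m Q t) j ord_max) ^+ 2
      = U t ord_max ord_max ^+ 2.
    under eq_bigr do rewrite exprMn.
    by rewrite -mulr_sumr (weight_sum (flow_eigenbasis t).1) mulr1.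
  rewrite -W (bigD1 i) //= flow_coord eqxx -weight_off // mulr_sumr.
  congr (_ + _).
  by apply: eq_bigr => j /negbTE ji; rewrite flow_coord ji exprMn.
have w0 := weight_ge0 V i.
have h : (1 - t) ^+ 2 <= 1.
  by rewrite -[leRHS](expr1n _ 2) lerXn2r ?nnegrE //; lra.
have := ler_wpM2r w0 h; lra.
Qed.

Let S1 := \sum_j weight V j * (lam j - lam i).
Let S2 := \sum_j weight V j * (lam j - lam i) ^+ 2.

Lemma flow_moment2 t :
  \sum_j weight (V *m Q t) j * (lam j - lam i) ^+ 2 = flow_ratio t * S2.
Proof.
rewrite mulr_sumr; apply: eq_bigr => j _.
have [->|ji] := eqVneq j i; first by rewrite subrr expr0n !mulr0.
by rewrite flow_weight // -mulrA.
Qed.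

Lemma flow_moment1 t :
  \sum_j weight (V *m Q t) j * (lam j - lam i) = flow_ratio t * S1.
Proof.
rewrite mulr_sumr; apply: eq_bigr => j _.
have [->|ji] := eqVneq j i; first by rewrite subrr !mulr0.
by rewrite flow_weight // -mulrA.
Qed.

Lemma centered_mean T' V' : TLambda lam T' -> eigenbasis lam T' V' ->
  T' ord_max ord_max - lam i = \sum_j weight V' j * (lam j - lam i).
Proof.
move=> [T'sym tT' _] hV'; under eq_bigr do rewrite mulrBr.
rewrite sumrB -mulr_suml weight_sum; last exact: hV'.1.
by rewrite mul1r (weight_mean T'sym tT' hV').
Qed.

Lemma flow_corner t : flow_at t ord_max ord_max - lam i = flow_ratio t * S1.
Proof.
by rewrite (centered_mean (flow_TLambda t) (flow_eigenbasis t)) flow_moment1.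
Qed.

Lemma flow_bot t : bot (flow_at t) ^+ 2 =
  flow_ratio t * S2 - (flow_ratio t * S1) ^+ 2.
Proof.
have [Fsym tF _] := flow_TLambda t.
have := weight_moment (lam i) Fsym tF (flow_eigenbasis t).
by rewrite flow_moment2 flow_corner => ->; rewrite addrK.
Qed.

Lemma base_bot : bot T ^+ 2 = S2 - S1 ^+ 2.
Proof.
rewrite -[S1](centered_mean hT hV) [S2](weight_moment (lam i) Tsym tT hV).
by rewrite addrK.
Qed.

(** With S1 and S2 the moments about lam i and r the ratio, the claim is
    r S2 - r^2 S1^2 <= S2 - S1^2, which follows from 2 S1^2 <= S2. This is where
    w_i >= 1/2 is used: the spectral measure without the mass at lam i has total
    mass at most 1/2. *)
Lemma flow_bot_le t : 2^-1 <= weight V i -> 0 <= t <= 1 ->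
  `|bot (flow_at t)| <= `|bot T|.
Proof.
move=> wi /flow_ratio_le1 /andP[r0 r1].
have S12 : 2 * S1 ^+ 2 <= S2.
  (* expanding this square replaces the Cauchy-Schwarz inequality *)
  have : 0 <= \sum_(j | j != i) weight V j * (lam j - lam i - 2 * S1) ^+ 2.
    by apply: sumr_ge0 => j _; rewrite mulr_ge0 ?weight_ge0 ?sqr_ge0.
  have e2 : S2 = \sum_(j | j != i) weight V j * (lam j - lam i) ^+ 2.
    by rewrite /S2 (bigD1 i) //= subrr expr0n mulr0 add0r.
  have e1 : S1 = \sum_(j | j != i) weight V j * (lam j - lam i).
    by rewrite /S1 (bigD1 i) //= subrr mulr0 add0r.
  have expand s : \sum_(j | j != i) weight V j * (lam j - lam i - 2 * s) ^+ 2 =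
      \sum_(j | j != i) weight V j * (lam j - lam i) ^+ 2
      - 4 * s * (\sum_(j | j != i) weight V j * (lam j - lam i))
      + 4 * s ^+ 2 * (\sum_(j | j != i) weight V j).
    rewrite !mulr_sumr -sumrB -big_split /=.
    by apply: eq_bigr => j _; ring.
  rewrite expand -e2 -e1 weight_off //.
  have := sqr_ge0 S1 => s0; have := ler_wpM2l s0 wi; lra.
rewrite -(@ler_pXn2r _ 2%N) ?nnegrE // !real_normK ?num_real //.
rewrite flow_bot base_bot; set r := flow_ratio t in r0 r1 *.
have s0 := sqr_ge0 S1.
have h1 : 0 <= (1 - r) * (S2 - 2 * S1 ^+ 2) by rewrite mulr_ge0 //; lra.
have h2 : 0 <= (1 - r) * (1 - r) * S1 ^+ 2.
  by rewrite mulr_ge0 // mulr_ge0 //; lra.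
lra.
Qed.

(** Q 0 is orthogonal and triangular with positive diagonal. *)
Lemma flow_start : flow_at 0 = T.
Proof.
suff Q0 : Q 0 = 1%:M by rewrite /flow_at Q0 trmx1 mul1mx mulmx1.
have QU : 1%:M = Q 0 *m U 0.
  rewrite -(flow_factor flow); apply/matrixP => a b.
  rewrite [RHS]mxE; case: eqP => [->|_].
    by rewrite !mxE subr0 mul1r mul0r mul0r addr0 eqxx andbT.
  by rewrite /damping scale0r subr0.
have UU : (U 0)^T *m U 0 = 1%:M - 0.
  rewrite subr0 -[RHS](mulmx1 1%:M) -{1}(trmx1 _ n.+2) QU trmx_mul -!mulmxA.
  by rewrite (mulmxA (Q 0)^T) (flow_orthogonal flow) mul1mx.
have E0 (a b : 'I_n.+2) : `|(0 : 'M[R]_n.+2) a b| <= 0 by rewrite mxE normr0.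
have := cholesky_near_identity (flow_upper flow 0) (flow_pos flow 0) UU E0.
rewrite !mulr0 invr_ge0 ler0n => /(_ isT) hU.
have U1 : U 0 = 1%:M.
  apply/matrixP => a b; apply/eqP.
  rewrite mxE -subr_eq0 -normr_le0 -mulr_natr mul1r.
  exact: hU.
by rewrite QU U1 mulmx1.
Qed.

Lemma flow_end : deflation0_at lam i (flow_at 1).
Proof.
have r0 : flow_ratio 1 = 0 by rewrite /flow_ratio subrr expr0n mul0r.
split; first exact: flow_TLambda.
  by apply/eqP; rewrite -sqrf_eq0 flow_bot r0 !mul0r expr0n subr0.
by apply/eqP; rewrite -subr_eq0 flow_corner r0 mul0r.
Qed.

End Flow.

Lemma deflation_at_weight T V i eps : TLambda lam T -> eigenbasis lam T V ->
  2^-1 <= weight V i -> `|bot T| <= eps -> deflation_at lam eps i T.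
Proof.
move=> hT hV wi bT.
have Vi : V i ord_max != 0.
  apply: contraTneq wi; rewrite /weight => ->.
  by rewrite expr0n /= -ltNge invr_gt0 ltr0n.
have [Q [U flow]] := deflation_flow_exists hV.1 Vi.
exists (flow_at T Q 1); first exact: flow_end hT hV flow.
apply: (@connected_component_max _ _ (flow_at T Q @` `[0, 1]%classic)).
- by exists 1 => //=; rewrite in_itv /= lexx ler01.
- move=> _ [t /= t01 <-]; rewrite in_itv /= in t01; split.
    exact: flow_TLambda hT hV flow _.
  by apply: le_trans bT; exact: (flow_bot_le hT hV flow).
- apply: connected_continuous_connected; first exact: segment_connected.
  apply: continuous_subspaceT.
  apply: continuous_mulmx; last exact: flow_continuous flow.
  apply: continuous_mulmx; last by move=> t; exact: cvg_cst.
  exact: continuous_trmx (flow_continuous flow).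
- exists 0; first by rewrite /= in_itv /= lexx ler01.
  exact: flow_start flow.
Qed.

Lemma TLambda_eigenbasis T : injective lam -> TLambda lam T ->
  exists V, eigenbasis lam T V.
Proof.
move=> li [Tsym _ sp]; apply: eigenbasis_exists => // i.
suff : [set x | eigenvalue T x] (lam i) by [].
by rewrite sp; exists i.
Qed.

(** On the whole neighborhood the corner entry is within eps of an eigenvalue,
    so on a connected part of it that meets lam i it cannot cross the values
    lam i + 2 eps and lam i - 2 eps. *)
Lemma deflation_at_corner T i eps g : injective lam -> 0 < eps ->
  4 * eps <= g -> (forall j k, j != k -> g <= `|lam j - lam k|) ->
  deflation_at lam eps i T -> `|T ord_max ord_max - lam i| <= eps.
Proof.
move=> li e0 eg hg [T0 [hT0 b0 c0]] CT.
set C := connected_component _ _ in CT.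
have CD : C `<=` deflation lam eps by exact: connected_component_sub.
have near_ev T' : C T' -> exists j, `|lam j - T' ord_max ord_max| <= eps.
  move=> /CD[hT' bT']; have [V hV] := TLambda_eigenbasis li hT'.
  have [sT' tT' _] := hT'.
  have [j hj] := nearest_eigenvalue sT' tT' hV; exists j; exact: le_trans bT'.
have CI : is_interval ((fun M : 'M[R]_n.+2 => M ord_max ord_max) @` C).
  apply/connected_intervalP/connected_continuous_connected.
    exact: component_connected.
  by apply: continuous_subspaceT; exact: coord_continuous.
have CT0 : C T0.
  by apply: connected_component_refl; split => //; rewrite b0 normr0 ltW.
have no_mid x : `|x - lam i| = 2 * eps ->
    ~ ((fun M : 'M[R]_n.+2 => M ord_max ord_max) @` C) x.
  move=> xi [T' CT' /= T'x]; have [k] := near_ev _ CT'; rewrite T'x => hk.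
  have [ki|ki] := eqVneq k i; first by move: hk; rewrite ki distrC xi; lra.
  have := hg _ _ ki; have := ler_normD (lam k - x) (x - lam i).
  rewrite addrA subrK xi; lra.
have [j hj] := near_ev _ CT.
have [ji|ji] := eqVneq j i; first by rewrite distrC -ji.
have gji := hg _ _ ji; set c := T ord_max ord_max in hj *.
have imT : ((fun M : 'M[R]_n.+2 => M ord_max ord_max) @` C) c by exists T.
have imT0 : ((fun M : 'M[R]_n.+2 => M ord_max ord_max) @` C) (lam i) by exists T0.
exfalso; have [lij|lij] := leP (lam i) (lam j).
  rewrite ger0_norm ?subr_ge0 // in gji.
  apply: (no_mid (lam i + 2 * eps)).
    by rewrite addrC addKr ger0_norm //; lra.
  apply: (CI _ _ imT0 imT); move: hj; rewrite ler_norml => /andP[h1 h2].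
  by apply/andP; split; lra.
rewrite ltr0_norm ?subr_lt0 // in gji.
apply: (no_mid (lam i - 2 * eps)).
  by rewrite addrAC subrr add0r normrN ger0_norm //; lra.
apply: (CI _ _ imT imT0); move: hj; rewrite ler_norml => /andP[h1 h2].
by apply/andP; split; lra.
Qed.

End DeflationPath.

(** * Distance from the end of the path to the decoupled matrix *)

Section FlowEnd.
Context {R : realType} {n : nat}.
Variable lam : 'I_n.+2 -> R.
Implicit Types M V T : 'M[R]_n.+2.

Lemma orthogonal_entry_le1 V i j : V *m V^T = 1%:M -> `|V i j| <= 1.
Proof.
move=> VV; rewrite -(@ler_pXn2r _ 2%N) ?nnegrE // real_normK ?num_real // expr1n.
have := congr1 (fun A : 'M[R]_n.+2 => A i i) VV; rewrite mxE [RHS]mxE eqxx => h.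
apply: le_trans (_ : \sum_k V i k * V^T k i <= 1); last by rewrite h.
rewrite (bigD1 j) //= mxE -expr2 lerDl; apply: sumr_ge0 => k _.
by rewrite mxE -expr2 sqr_ge0.
Qed.

(* a crude bound for the entries of all matrices with this spectrum *)
Let spectral_size := \sum_j `|lam j|.

Lemma spectral_size_ge0 : 0 <= spectral_size.
Proof. by apply: sumr_ge0 => j _. Qed.

Lemma eigenbasis_entry_le T V i j : eigenbasis lam T V ->
  `|T i j| <= spectral_size.
Proof.
move=> [VV VT].
have -> : T = V^T *m (diag_mx (\row_j lam j) *m V).
  by rewrite -VT mulmxA (mulmx1C VV) mul1mx.
rewrite mul_diag_mx mxE; apply: le_trans (ler_norm_sum _ _ _) _.
apply: ler_sum => k _; rewrite !mxE !normrM.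
have h1 := orthogonal_entry_le1 k i VV; have h2 := orthogonal_entry_le1 k j VV.
by rewrite mulrCA ler_piMr // mulr_ile1.
Qed.

Variables (T V : 'M[R]_n.+2) (i : 'I_n.+2) (Q U : R -> 'M[R]_n.+2).
Hypotheses (hT : TLambda lam T) (hV : eigenbasis lam T V).
Hypothesis flow : deflation_flow V i Q U.

Let VV : V *m V^T = 1%:M. Proof. exact: hV.1. Qed.
Let B := damping V i 1.
Let x := 1 - weight V i.
Hypothesis x_small : n.+2%:R * x <= 2^-1.

Let B_sym : B^T = B.
Proof.
rewrite /B /damping linearB /= linearZ /= trmx1 /eigenprojection trmx_mul.
by rewrite trmxK.
Qed.

Let BB : B *m B = B.
Proof.
rewrite /B /damping scale1r; set P := eigenprojection V i.
have PP : P *m P = P.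
  rewrite /P /eigenprojection mulmxA -(mulmxA _ (row i V)) eigenrow_unit //.
  by rewrite mulmx1.
by rewrite mulmxBl mul1mx mulmxBr mulmx1 PP subrr subr0.
Qed.

Let Bentry a b : B a b = (a == b)%:R - V i a * V i b.
Proof. by rewrite /B /damping scale1r !mxE big_ord1 !mxE. Qed.

Let eigenrow_entry a : a != ord_max -> V i a ^+ 2 <= x.
Proof.
move=> am; have := congr1 (fun A : 'M[R]_n.+2 => A i i) VV.
rewrite mxE [RHS]mxE eqxx (bigD1 ord_max) //= (bigD1 a) //= !mxE -!expr2 => h.
have : 0 <= \sum_(k | (k != ord_max) && (k != a)) V i k * V^T k i.
  by apply: sumr_ge0 => k _; rewrite mxE -expr2 sqr_ge0.
rewrite /x /weight; move: h; set s := \sum_(k | _) _; lra.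
Qed.

Let x_ge0 : 0 <= x.
Proof.
by rewrite /x -weight_off //; apply: sumr_ge0 => j _; exact: weight_ge0.
Qed.

(** The Gram matrix differs from 1 by the products of two coordinates of the
    eigenvector v, neither of them the last, and by 1 - (v_last)^2 in the
    corner; all of these are at most x. *)
Let gram_entry a b : `|(1%:M - (U 1)^T *m U 1) a b| <= x.
Proof.
have -> : (U 1)^T *m U 1 = (Q 1 *m U 1)^T *m (Q 1 *m U 1).
  by rewrite trmx_mul mulmxA -(mulmxA (U 1)^T) (flow_orthogonal flow) mulmx1.
rewrite -(flow_factor flow).
set A := set_last_col _ _.
have dot c d : (A^T *m A) c d = \sum_k A k c * A k d.
  by rewrite mxE; apply: eq_bigr => k _; rewrite [_^T _ _]mxE.
have Amax k : A k ord_max = V i ord_max * V i k.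
  by rewrite mxE eqxx /damping_normal subrr scale0r add0r mul1r !mxE.
have Aoff k c : c != ord_max -> A k c = B k c by exact: set_last_col_0.
have Bdot c d : \sum_k B k c * B k d = B c d.
  rewrite -[in RHS]BB [RHS]mxE.
  by apply: eq_bigr => k _; rewrite -{1}B_sym mxE.
have vdot c : \sum_k V i k * B k c = 0.
  have vB : row i V *m B = 0.
    rewrite /B /damping scale1r mulmxBr mulmx1 mulmxA eigenrow_unit // mul1mx.
    by rewrite subrr.
  transitivity ((row i V *m B) 0 c); last by rewrite vB mxE.
  by rewrite mxE; apply: eq_bigr => k _; rewrite [row _ _ _ _]mxE.
have x1 : `|x| <= x by rewrite ger0_norm.
rewrite mxE [X in _ + X]mxE dot [X in X - _]mxE.
have [->|am] := eqVneq a ord_max; have [->|bm] := eqVneq b ord_max.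
- have -> : \sum_k A k ord_max * A k ord_max = weight V i.
    under eq_bigr do rewrite !Amax mulrACA.
    rewrite -mulr_sumr.
    have := congr1 (fun M : 'M[R]_n.+2 => M i i) VV; rewrite mxE [RHS]mxE eqxx.
    under eq_bigr do rewrite [_^T _ _]mxE.
    by move=> ->; rewrite mulr1 /weight expr2.
  exact: x1.
- rewrite mulr0n sub0r normrN.
  under eq_bigr do rewrite Amax Aoff // -mulrA.
  by rewrite -mulr_sumr vdot mulr0 normr0.
- rewrite (negbTE am) sub0r normrN.
  under eq_bigr do rewrite Amax Aoff // [B _ _ * _]mulrC -mulrA.
  by rewrite -mulr_sumr vdot mulr0 normr0.
- under eq_bigr do rewrite !Aoff //.
  rewrite Bdot Bentry opprB addrC subrK.
  have ha := eigenrow_entry am; have hb := eigenrow_entry bm.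
  rewrite normrM; rewrite -(real_normK (num_real (V i a))) in ha.
  rewrite -(real_normK (num_real (V i b))) in hb.
  have := sqr_ge0 (`|V i a| - `|V i b|); nra.
Qed.

Let U_close a b : `|U 1 a b - (a == b)%:R| <= 2 * n.+2%:R * x.
Proof.
apply: (cholesky_near_identity (flow_upper flow 1) (flow_pos flow 1)
  (E := 1%:M - (U 1)^T *m U 1)) => //.
by rewrite opprB addrC subrK.
Qed.

Let F := flow_at T Q 1.
Let Rfac := (Q 1)^T *m B.

Let factor_last k : Rfac k ord_max ^+ 2 <= x.
Proof.
have QQ := mulmx1C (flow_orthogonal flow 1).
have : (Rfac^T *m Rfac) ord_max ord_max = x.
  rewrite /Rfac trmx_mul trmxK B_sym mulmxA -(mulmxA B) QQ mulmx1 BB Bentry eqxx.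
  by rewrite /x /weight expr2.
rewrite mxE (bigD1 k) //= mxE -expr2 => <-; rewrite lerDl.
by apply: sumr_ge0 => l _; rewrite mxE -expr2 sqr_ge0.
Qed.

(** From F R = R T with R = Q^T (1 - v v^T). The columns of R but the last are
    those of U, hence within O(x) of the identity; the last one has length at
    most sqrt x and only meets the entry bot T of T. *)
Lemma flow_end_block (h : R) k l : 0 <= h -> x <= h ^+ 2 ->
  k != ord_max -> l != ord_max ->
  `|F k l - T k l| <= 4 * n.+2%:R ^+ 2 * spectral_size * x + h * `|bot T|.
Proof.
move=> h0 xh km lm.
have hF : eigenbasis lam F (V *m Q 1) by exact: flow_eigenbasis hV flow 1.
have FR : F *m Rfac = Rfac *m T.
  have QQ := mulmx1C (flow_orthogonal flow 1).
  have [sT _ _] := hT.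
  rewrite /F /flow_at /Rfac mulmxA -(mulmxA _ (Q 1)) QQ mulmx1 -!mulmxA.
  by rewrite (damping_commute i 1 sT hV).
have Roff a b : b != ord_max -> Rfac a b = U 1 a b.
  by move=> bm; rewrite /Rfac /B (flow_damping flow).
have s0 := spectral_size_ge0.
have N0 : 0 <= n.+2%:R :> R by [].
have E1 : \sum_j F k j * Rfac j l =
    F k l + \sum_j F k j * (U 1 j l - (j == l)%:R).
  have -> : F k l = \sum_j F k j * (j == l)%:R.
    rewrite (bigD1 l) //= eqxx mulr1 big1 ?addr0 // => j /negbTE ->.
    by rewrite mulr0.
  rewrite -big_split /=; apply: eq_bigr => j _; rewrite Roff //; ring.
have E2 : \sum_j Rfac k j * T j l = T k l +
    \sum_(j | j != ord_max) (U 1 k j - (k == j)%:R) * T j l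
    + Rfac k ord_max * T ord_max l.
  have -> : T k l = \sum_(j | j != ord_max) (k == j)%:R * T j l.
    rewrite (bigD1 k) //= eqxx mul1r big1 ?addr0 // => j /andP[_].
    by rewrite eq_sym => /negbTE ->; rewrite mul0r.
  rewrite (bigD1 ord_max) //= addrC; congr (_ + _).
  rewrite -big_split /=; apply: eq_bigr => j jm; rewrite Roff //; ring.
have E : F k l - T k l =
    \sum_(j | j != ord_max) (U 1 k j - (k == j)%:R) * T j l
    + Rfac k ord_max * T ord_max l - \sum_j F k j * (U 1 j l - (j == l)%:R).
  have := congr1 (fun M : 'M[R]_n.+2 => M k l) FR.
  rewrite mxE [RHS]mxE E1 E2; lra.
have c0 : 0 <= 2 * n.+2%:R * x by rewrite mulr_ge0 // mulr_ge0.
have b1 : `|\sum_(j | j != ord_max) (U 1 k j - (k == j)%:R) * T j l| <=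
    n.+2%:R * (2 * n.+2%:R * x * spectral_size).
  apply: le_trans (ler_norm_sum _ _ _) _.
  apply: (@le_trans _ _ (\sum_(j < n.+2) 2 * n.+2%:R * x * spectral_size)).
    rewrite [leRHS](bigID (fun j => j != ord_max)) /= -[leLHS]addr0 lerD //.
      apply: ler_sum => j _; rewrite normrM ler_pM //.
      exact: eigenbasis_entry_le hV.
    by apply: sumr_ge0 => j _; rewrite mulr_ge0.
  by rewrite sumr_const card_ord -[_ *+ n.+2]mulr_natl.
have b2 : `|\sum_j F k j * (U 1 j l - (j == l)%:R)| <=
    n.+2%:R * (spectral_size * (2 * n.+2%:R * x)).
  apply: le_trans (ler_norm_sum _ _ _) _.
  apply: (@le_trans _ _ (\sum_(j < n.+2) spectral_size * (2 * n.+2%:R * x))).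
    apply: ler_sum => j _; rewrite normrM ler_pM //.
    exact: eigenbasis_entry_le hF.
  by rewrite sumr_const card_ord -[_ *+ n.+2]mulr_natl.
have b3 : `|Rfac k ord_max * T ord_max l| <= h * `|bot T|.
  rewrite normrM ler_pM //.
    rewrite -(@ler_pXn2r _ 2%N) ?nnegrE // real_normK ?num_real //.
    exact: le_trans (factor_last k) xh.
  have [_ tT _] := hT.
  rewrite tridiagonal_last_row //.
  by case: eqP => _; rewrite ?mulr1 // mulr0 normr0.
rewrite E; apply: le_trans (ler_normB _ _) _.
have := ler_normD (\sum_(j | j != ord_max) (U 1 k j - (k == j)%:R) * T j l)
  (Rfac k ord_max * T ord_max l).
move: b1 b2 b3; set y1 := `|_|; set y2 := `|_|; set y3 := `|_|; set y4 := `|_|.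
move=> b1 b2 b3 b4.
have -> : 4 * n.+2%:R ^+ 2 * spectral_size * x =
  n.+2%:R * (2 * n.+2%:R * x * spectral_size) +
  n.+2%:R * (spectral_size * (2 * n.+2%:R * x)) by ring.
lra.
Qed.

Lemma corner_close : `|T ord_max ord_max - lam i| <= 2 * spectral_size * x.
Proof.
rewrite (centered_mean i hT hV) (bigD1 i) //= subrr mulr0 add0r.
apply: le_trans (ler_norm_sum _ _ _) _.
rewrite /x -weight_off // mulr_sumr; apply: ler_sum => j ji.
rewrite normrM (ger0_norm (weight_ge0 _ _)) mulrC ler_wpM2r ?weight_ge0 //.
have le1 k : `|lam k| <= spectral_size.
  by rewrite /spectral_size (bigD1 k) //= lerDl; apply: sumr_ge0 => ? _.
have := ler_normB (lam j) (lam i); have := le1 i; have := le1 j; lra.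
Qed.

(** For a tridiagonal matrix this only drops the two entries equal to bot M. *)
Definition decoupled M : 'M[R]_n.+2 :=
  \matrix_(a, b) if (a == ord_max) == (b == ord_max) then M a b else 0.

(** Applied with x = O(b^2) and h = O(b), so that the distance is O(b^2). The
    last row of F is exactly that of a deflated matrix, and in the corner the
    weights give the bound. *)
Lemma flow_end_decoupled (h : R) : 0 <= h -> x <= h ^+ 2 ->
  `|F - decoupled T| <=
     (4 * n.+2%:R ^+ 2 + 2) * spectral_size * x + h * `|bot T|.
Proof.
move=> h0 xh; have s0 := spectral_size_ge0.
have [[Fsym tF _] F0 Fl] : deflation0_at lam i F by exact: flow_end hT hV flow.
have p1 : 0 <= spectral_size * x by rewrite mulr_ge0.
have p2 : 0 <= h * `|bot T| by rewrite mulr_ge0.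
have N0 : 0 <= n.+2%:R ^+ 2 :> R by rewrite exprn_ge0.
have p3 : 0 <= 4 * n.+2%:R ^+ 2 * (spectral_size * x).
  by rewrite mulr_ge0 // mulr_ge0.
have Frow l : l != ord_max -> F ord_max l = 0.
  by move=> lm; rewrite tridiagonal_last_row // F0 mul0r.
apply: mx_norm_le => [|a b]; first lra.
rewrite mxE [X in _ + X]mxE [decoupled _ _ _]mxE.
have [->|am] := eqVneq a ord_max; have [->|bm] := eqVneq b ord_max => /=.
- rewrite Fl distrC; have := corner_close; lra.
- rewrite Frow // subr0 normr0; lra.
- rewrite -Fsym mxE Frow // subr0 normr0; lra.
- have := flow_end_block h0 xh am bm; lra.
Qed.

End FlowEnd.

(** * Second differences and local bounds for smooth functions *)

Section Taylor.
Context {R : realType} {V : normedModType R}.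
Implicit Types (f : V -> R) (x v : V).

Lemma is_derive_line f x v (s : R) : differentiable f (x + s *: v) ->
  is_derive s 1 (fun t : R => f (x + t *: v)) ('D_v f (x + s *: v)).
Proof.
move=> df; have dv : derivable f (x + s *: v) v by exact: diff_derivable.
have E : (fun h : R => h^-1 *: (f (x + (h *: (1 : R) + s) *: v) - f (x + s *: v)))
       = (fun h : R => h^-1 *: (f (h *: v + (x + s *: v)) - f (x + s *: v))).
  apply/funext => h; congr (_ *: (f _ - _)).
  by rewrite scalerDl addrCA /GRing.scale /= mulr1.
apply: DeriveDef.
  by rewrite /derivable /= E; exact: dv.
by rewrite /derive /= E.
Qed.

Lemma line_mean_value f x v (a b : R) : a <= b ->
  (forall s, a <= s <= b -> differentiable f (x + s *: v)) ->
  exists2 c, a <= c <= b &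
    f (x + b *: v) - f (x + a *: v) = 'D_v f (x + c *: v) * (b - a).
Proof.
move=> ab df.
have [||c cab E] := @MVT_segment R (fun t => f (x + t *: v))
   (fun t => 'D_v f (x + t *: v)) a b ab.
- move=> s; rewrite in_itv /= => /andP[h1 h2]; apply: is_derive_line.
  by apply: df; rewrite !ltW.
- apply: derivable_within_continuous => s; rewrite in_itv /= => h.
  by have [] := is_derive_line (df s h).
- by exists c => //; rewrite in_itv /= in cab.
Qed.

(** Mean values of the first derivative on both sides of x, then of the second
    derivative between them. *)
Lemma second_difference f x v (b C : R) : 0 <= b ->
  (forall s, - b <= s <= b -> differentiable f (x + s *: v)) ->
  (forall s, - b <= s <= b -> differentiable ('D_v f) (x + s *: v)) ->
  (forall s, - b <= s <= b -> `|'D_v ('D_v f) (x + s *: v)| <= C) ->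
  `|f (x + b *: v) + f (x - b *: v) - 2 * f x| <= 2 * C * b ^+ 2.
Proof.
move=> b0 df ddf bd.
have [|c1 /andP[c10 c1b] E1] := @line_mean_value f x v 0 b b0.
  by move=> s /andP[h1 h2]; apply: df; apply/andP; split; lra.
have [||c2 /andP[c20 c2b] E2] := @line_mean_value f x v (- b) 0.
- by rewrite oppr_le0.
- by move=> s /andP[h1 h2]; apply: df; apply/andP; split; lra.
have [||c /andP[cc1 cc2] E3] := @line_mean_value ('D_v f) x v c2 c1.
- lra.
- by move=> s /andP[h1 h2]; apply: ddf; apply/andP; split; lra.
move: E1 E2; rewrite scale0r addr0 subr0 scaleNr => E1 E2.
have -> : f (x + b *: v) + f (x - b *: v) - 2 * f x =
   'D_v ('D_v f) (x + c *: v) * (c1 - c2) * b by rewrite -E3; lra.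
have hb : `|'D_v ('D_v f) (x + c *: v)| <= C.
  by apply: bd; apply/andP; split; lra.
rewrite !normrM (ger0_norm b0) (ger0_norm (_ : 0 <= c1 - c2)); last lra.
have C0 : 0 <= C := le_trans (normr_ge0 _) hb.
have := ler_pM (normr_ge0 _) (_ : 0 <= c1 - c2) hb (_ : c1 - c2 <= 2 * b).
move=> /(_ ltac:(lra) ltac:(lra)) h; have := ler_wpM2r b0 h.
by move=> h'; apply: le_trans h' _; lra.
Qed.

End Taylor.

Section LocalBounds.
Context {R : realType} {n : nat}.
Implicit Types (x v H : 'M[R]_n.+2) (U : set 'M[R]_n.+2) (f : 'M[R]_n.+2 -> R).

Lemma derive_coord_bound f x v C : differentiable f x ->
  (forall i j, `|'D_(delta_mx i j) f x| <= C) ->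
  `|'D_v f x| <= n.+2%:R ^+ 2 * C * `|v|.
Proof.
move=> df hC.
have -> : 'D_v f x = \sum_i \sum_j v i j * 'D_(delta_mx i j) f x.
  rewrite deriveE // {1}[v]matrix_sum_delta linear_sum; apply: eq_bigr => i _.
  rewrite linear_sum; apply: eq_bigr => j _.
  by rewrite linearZ deriveE.
apply: le_trans (ler_norm_sum _ _ _) _.
apply: (@le_trans _ _ (\sum_(i < n.+2) n.+2%:R * (C * `|v|))).
  apply: ler_sum => i _; apply: le_trans (ler_norm_sum _ _ _) _.
  apply: (@le_trans _ _ (\sum_(j < n.+2) C * `|v|)).
    by apply: ler_sum => j _; rewrite normrM mulrC ler_pM // mx_norm_ge.
  by rewrite sumr_const card_ord -[_ *+ n.+2]mulr_natl.
by rewrite sumr_const card_ord -[_ *+ n.+2]mulr_natl; lra.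
Qed.

Lemma differentiable_bounded_near f x : differentiable f x ->
  \forall y \near x, `|f y| <= `|f x| + 1.
Proof.
move=> /differentiable_continuous cf.
have cn : (fun y => `|f y|) @ x --> `|f x| by exact: cvg_norm cf.
near=> y; apply: ltW; near: y.
by apply: (cvgr_lt _ cn); rewrite ltrDl.
Unshelve. all: by end_near. Qed.

(** The second derivative is only needed along one direction H; the first
    derivatives along the elementary matrices control all others. *)
Lemma smooth_local_bounds U f x H : open U -> U x -> smooth_on_open U f ->
  exists r C : R, [/\ 0 < r, 0 <= C & forall y, `|y - x| < r ->
    [/\ U y, `|'D_H ('D_H f) y| <= C &
        forall i j, `|'D_(delta_mx i j) f y| <= C]].
Proof.
move=> oU Ux sf.
pose c i j := `|'D_(delta_mx i j) f x| + 1.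
pose C := (`|'D_H ('D_H f) x| + 1) + \sum_i \sum_j c i j.
have c0 i j : 0 <= c i j by rewrite addr_ge0.
have cS i j : c i j <= \sum_i \sum_j c i j.
  rewrite (bigD1 i) //= (bigD1 j) //= -addrA lerDl addr_ge0 //.
    by apply: sumr_ge0 => k _; exact: c0.
  by apply: sumr_ge0 => k _; apply: sumr_ge0 => l _; exact: c0.
have S0 : 0 <= \sum_i \sum_j c i j.
  by apply: sumr_ge0 => i _; apply: sumr_ge0 => j _; exact: c0.
have : \forall y \near x, [/\ U y, `|'D_H ('D_H f) y| <= C &
        forall i j, `|'D_(delta_mx i j) f y| <= C].
  have h1 := open_nbhs_nbhs (conj oU Ux).
  have h2 := differentiable_bounded_near (sf [:: H; H] x Ux).
  have h3 : \forall y \near x, forall i j, `|'D_(delta_mx i j) f y| <= c i j.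
    pose A i j y := `|'D_(delta_mx i j) f y| <= c i j.
    apply: (@filter_forall _ _ (fun i y => forall j, A i j y) _
      (nbhs_filter x)) => i.
    apply: (@filter_forall _ _ (A i) _ (nbhs_filter x)) => j.
    exact: differentiable_bounded_near (sf [:: delta_mx i j] x Ux).
  near=> y; split; first by near: y.
    apply: (@le_trans _ _ (`|'D_H ('D_H f) x| + 1)); first by near: y.
    by rewrite lerDl.
  move=> i j; apply: (@le_trans _ _ (c i j)).
    by move: i j; near: y.
  by apply: le_trans (cS i j) _; rewrite lerDr addr_ge0.
move/nbhs_ballP => [r /= r0 hr]; exists r, C; split => //.
  by rewrite addr_ge0 // addr_ge0.
by move=> y yx; apply: hr; rewrite -ball_normE /ball_ /= distrC.
Unshelve. all: by end_near. Qed.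

End LocalBounds.

(** * Invariance and convergence rates *)

Section Main.
Context {R : realType} {n : nat}.
Variables (lam : 'I_n.+2 -> R) (sigma : 'M[R]_n.+2 -> R).
Implicit Types M V T : 'M[R]_n.+2.

Definition coupling : 'M[R]_n.+2 :=
  delta_mx ord_max (inord n) + delta_mx (inord n) ord_max.

(** Conjugation by this sign matrix changes the sign of bot T and fixes the
    decoupled part. *)
Definition last_flip : 'M[R]_n.+2 :=
  diag_mx (\row_j if j == ord_max then -1 else 1).

Lemma inord_neq_max : (inord n : 'I_n.+2) != ord_max.
Proof. by rewrite -val_eqE /= inordK // neq_ltn ltnSn. Qed.

Lemma last_flip_entry T a b : (last_flip *m T *m last_flip) a b =
  if (a == ord_max) == (b == ord_max) then T a b else - T a b.
Proof.
rewrite mul_mx_diag mxE mul_diag_mx !mxE.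
by case: (a == ord_max); case: (b == ord_max);
  rewrite /= ?mulN1r ?mulrN1 ?mulr1 ?mul1r ?opprK.
Qed.

Lemma coupling_entry T a b : T^T = T -> tridiagonal T ->
  (bot T *: coupling) a b =
  if (a == ord_max) == (b == ord_max) then 0 else T a b.
Proof.
move=> Tsym tT; have nm : (ord_max == inord n :> 'I_n.+2) = false.
  by rewrite eq_sym; exact: negbTE inord_neq_max.
have Tlast l : l != ord_max -> T ord_max l = bot T * (l == inord n)%:R.
  exact: tridiagonal_last_row.
rewrite !mxE.
have [->|am] := eqVneq a ord_max; have [->|bm] := eqVneq b ord_max => /=.
- by rewrite nm /= addr0 mulr0.
- by rewrite nm /= addr0 Tlast.
- have -> : T a ord_max = T ord_max a by rewrite -{1}Tsym mxE.
  by rewrite Tlast // andbT add0r.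
- by rewrite andbF addr0 mulr0.
Qed.

Lemma decoupled_plus T : T^T = T -> tridiagonal T ->
  decoupled T + bot T *: coupling = T.
Proof.
move=> Tsym tT; apply/matrixP => a b.
rewrite mxE coupling_entry // [decoupled _ _ _]mxE.
by case: ifP => _; rewrite ?addr0 ?add0r.
Qed.

Lemma decoupled_minus T : T^T = T -> tridiagonal T ->
  decoupled T - bot T *: coupling = last_flip *m T *m last_flip.
Proof.
move=> Tsym tT; apply/matrixP => a b.
rewrite last_flip_entry mxE [X in _ + X]mxE coupling_entry //.
rewrite [decoupled _ _ _]mxE.
by case: ifP => _; rewrite ?subr0 ?sub0r.
Qed.

Lemma last_flip_sign : sign_diag last_flip.
Proof.
split; first exact: diag_mx_is_diag.
by move=> i; rewrite !mxE eqxx; case: ifP => _; rewrite mulr1n; [right|left].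
Qed.

Lemma last_flip_sym : last_flip^T = last_flip.
Proof. exact: tr_diag_mx. Qed.

Lemma last_flip_sqr : last_flip *m last_flip = 1%:M.
Proof.
rewrite /last_flip mulmx_diag; apply/matrixP => i j; rewrite !mxE.
by case: ifP => _; rewrite ?mulr1 ?mulrNN ?mulr1.
Qed.

Lemma last_flip_TLambda T : TLambda lam T ->
  TLambda lam (last_flip *m T *m last_flip).
Proof.
move=> hT; have [_ tT _] := hT.
rewrite -{1}last_flip_sym; apply: TLambda_conj => //.
  by rewrite last_flip_sym last_flip_sqr.
rewrite last_flip_sym => a b ab.
by rewrite last_flip_entry tT // oppr0; case: ifP.
Qed.

Lemma coupling_norm : `|coupling| <= 2.
Proof.
have h (a b : 'I_n.+2) : `|delta_mx a b : 'M[R]_n.+2| <= 1.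
  apply: mx_norm_le => // i j; rewrite mxE.
  by case: (_ && _); rewrite ?normr1 ?normr0.
apply: le_trans (ler_normD _ _) _.
by have := lerD (h ord_max (inord n)) (h (inord n) ord_max).
Qed.

Lemma eigenvalue_gap : injective lam ->
  exists2 g : R, 0 < g & forall j k, j != k -> g <= `|lam j - lam k|.
Proof.
move=> li; exists (\big[Order.min/1]_(p : 'I_n.+2 * 'I_n.+2 | p.1 != p.2)
    `|lam p.1 - lam p.2|).
  apply: lt_bigmin => // -[j k] /= jk.
  by rewrite normr_gt0 subr_eq0; apply: contra jk => /eqP /li ->.
by move=> j k jk; apply: (@bigmin_le_cond _ _ _ _ (j, k) _
  (fun p => `|lam p.1 - lam p.2|)).
Qed.

Hypothesis lam_inj : injective lam.
Variables (C0 delta g : R).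
Hypothesis C0_gt0 : 0 < C0.
Hypothesis sigma_sym : forall T E, TLambda lam T -> sign_diag E ->
     sigma (E *m T *m E) = sigma T.
Hypothesis sigma_near : forall T, TLambda lam T ->
     exists i, `|sigma T - lam i| <= C0 * `|bot T|.
Hypothesis delta_gt0 : 0 < delta.
Hypothesis sigma_compat : forall i T, deflation_at lam delta i T ->
    forall j, `|sigma T - lam i| <= `|sigma T - lam j|.
Hypothesis g_gt0 : 0 < g.
Hypothesis gap : forall j k, j != k -> g <= `|lam j - lam k|.

Lemma sigma_near_at T i : deflation_at lam delta i T -> TLambda lam T ->
  `|sigma T - lam i| <= C0 * `|bot T|.
Proof.
move=> dT /sigma_near [j hj]; exact: le_trans (sigma_compat dT j) hj.
Qed.

(** At b = 0 the shift strategy has no slack: sigma T is an eigenvalue, and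
    compatibility says which. *)
Lemma sigma_deflated T i : deflation0_at lam i T -> sigma T = lam i.
Proof.
move=> dT; have [hT bT _] := dT.
apply/eqP; rewrite -subr_eq0 -normr_le0.
have := @sigma_near_at T i; rewrite bT normr0 mulr0; apply=> //.
exists T => //; apply: connected_component_refl; split => //.
by rewrite bT normr0 ltW.
Qed.

Lemma weight_large T V i : TLambda lam T -> eigenbasis lam T V ->
  `|T ord_max ord_max - lam i| <= g / 2 ->
  (1 - weight V i) * g ^+ 2 <= 4 * bot T ^+ 2.
Proof.
move=> [Tsym tT _] hV hc.
have h : forall j, j != i -> g / 2 <= `|lam j - T ord_max ord_max|.
  move=> j ji; have := gap ji.
  have := ler_normD (lam j - T ord_max ord_max) (T ord_max ord_max - lam i).
  rewrite addrA subrK; lra.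
have g2 : 0 <= g / 2 by rewrite divr_ge0 // ltW.
have := weight_concentration hV.1 g2 h.
rewrite (weight_moment _ Tsym tT hV) subrr expr0n addr0 expr_div_n.
by rewrite -[2 ^+ 2]/(2 * 2); lra.
Qed.

Let N : R := n.+2%:R.

(** Combines the second difference of f at m with the distance from m to a
    deflated matrix. The radius rho keeps T, its flip, the segment
    between them and the segment from m to the deflated matrix F in the ball
    where the derivatives of f are bounded. *)
Lemma quadratic_near_regular T0 : TLambda lam T0 -> bot T0 = 0 ->
  ~ singular_support (TLambda lam) sigma T0 ->
  exists rho C : R, [/\ 0 < rho, 0 <= C & forall T V i, `|T - T0| < rho ->
    TLambda lam T -> eigenbasis lam T V -> N * (1 - weight V i) <= 2^-1 ->
    (1 - weight V i) * g ^+ 2 <= 4 * bot T ^+ 2 ->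
    `|sigma T - lam i| <= C * bot T ^+ 2].
Proof.
move=> hT0 b0 nS.
have [[Z cZ SZ] sm] := singular_support_smooth (TLambda lam) sigma.
have [U0 [f [oU0 U0T0 sf0 sigf]]] := sm T0 (conj hT0 nS).
pose U := U0 `&` ~` Z.
have nZ : ~ Z T0 by move=> ZT0; apply: nS; rewrite SZ.
have oU : open U by apply: openI => //; exact: closed_openC.
have sf : smooth_on_open U f by move=> vs x [Ux _]; exact: sf0.
have sigU T : TLambda lam T -> U T -> sigma T = f T.
  move=> hT [U0T nZT]; apply: sigf; rewrite inE; split => //.
  by split => //; rewrite SZ => -[].
have [r [C [r0 C_ge0 hr]]] := smooth_local_bounds coupling oU (conj U0T0 nZ) sf.
pose L := \sum_j `|lam j|.
pose K := (4 * N ^+ 2 + 2) * L * (4 / g ^+ 2) + 2 / g.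
have N0 : 0 <= N by [].
have L0 : 0 <= L by apply: sumr_ge0.
have g20 : 0 < g ^+ 2 by rewrite exprn_gt0.
have q0 : 0 <= 4 * N ^+ 2 + 2 by rewrite addr_ge0 // mulr_ge0 // exprn_ge0.
have K0 : 0 <= K.
  apply: addr_ge0; last by rewrite divr_ge0 // ltW.
  by apply: mulr_ge0; [exact: mulr_ge0|rewrite divr_ge0 // ltW].
pose rho := Num.min 1 (r / (6 + K)).
have K6 : 0 < 6 + K by lra.
have rho0 : 0 < rho by rewrite lt_min ltr01 divr_gt0.
have rho1 : rho <= 1 by rewrite ge_min lexx.
have rhor : rho * (6 + K) <= r.
  by rewrite -ler_pdivlMr // ge_min lexx orbT.
exists rho, (C + N ^+ 2 * C * K); split => //.
  by rewrite addr_ge0 // mulr_ge0 // mulr_ge0 // exprn_ge0.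
move=> T V i TT0 hT hV Nx xg.
have [Tsym tT _] := hT.
set x := 1 - weight V i in Nx xg *.
have x0 : 0 <= x.
  by rewrite /x -weight_off ?hV.1 //; apply: sumr_ge0 => j _; exact: weight_ge0.
have xb : x <= 4 / g ^+ 2 * bot T ^+ 2.
  by rewrite mulrAC ler_pdivlMr.
have N2 : 2 <= N by rewrite /N ler_nat.
have Vi : V i ord_max != 0.
  apply/eqP => V0; have : x = 1 by rewrite /x /weight V0 expr0n subr0.
  move=> x1; move: Nx; rewrite x1; lra.
have [Q [W flow]] := deflation_flow_exists hV.1 Vi.
set m := decoupled T; set b := bot T in xb xg *.
set F := flow_at T Q 1.
have bT : `|b| < rho.
  apply: le_lt_trans TT0; rewrite /b -[bot T]subr0 -b0 /bot.
  by have := mx_norm_ge (T - T0) ord_max (inord n); rewrite !mxE.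
have Fm : `|F - m| <= K * b ^+ 2.
  have h0 : 0 <= 2 / g * `|b| by rewrite mulr_ge0 // divr_ge0 // ltW.
  have xh : x <= (2 / g * `|b|) ^+ 2.
    by rewrite exprMn expr_div_n real_normK ?num_real // -natrX.
  apply: le_trans (flow_end_decoupled hT hV flow Nx h0 xh) _.
  have -> : 2 / g * `|b| * `|bot T| = 2 / g * b ^+ 2.
    by rewrite -/b -mulrA -expr2 real_normK ?num_real.
  rewrite /K [leRHS]mulrDl lerD // -[leRHS]mulrA ler_wpM2l //.
  exact: mulr_ge0.
have mT0 s : `|s| <= `|b| -> `|m + s *: coupling - T0| <= 5 * rho.
  move=> sb; have -> : m + s *: coupling - T0 = (T - T0) + (s - b) *: coupling.
    have Tm : T = m + b *: coupling by rewrite decoupled_plus.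
    rewrite [in RHS]Tm scalerBl [m + _ - T0 in RHS]addrAC -[RHS]addrA.
    by rewrite [_ + (_ - _) in RHS]addrCA subrr addr0 addrAC.
  apply: le_trans (ler_normD _ _) _; rewrite normrZ.
  have h1 := ler_normB s b.
  have h0 : `|s - b| <= 2 * rho by lra.
  have := ler_pM (normr_ge0 _) (normr_ge0 _) h0 coupling_norm; lra.
have inr s : `|s| <= `|b| -> `|m + s *: coupling - T0| < r.
  move=> /mT0 h; apply: le_lt_trans h _.
  have : 0 <= rho * K by rewrite mulr_ge0 // ltW.
  lra.
have b2 : b ^+ 2 <= rho.
  rewrite -[b ^+ 2]real_normK ?num_real // expr2.
  apply: (@le_trans _ _ (rho * 1)); last by rewrite mulr1.
  by apply: ler_pM => //; lra.
have inr2 c : 0 <= c <= 1 -> `|m + c *: (F - m) - T0| < r.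
  move=> /andP[c0 c1].
  have m0 := mT0 0; rewrite normr0 scale0r addr0 in m0.
  have {}m0 := m0 (normr_ge0 _).
  rewrite addrAC; apply: le_lt_trans (ler_normD _ _) _.
  rewrite normrZ ger0_norm //.
  have h1 := ler_wpM2l K0 b2.
  have h2 : c * `|F - m| <= 1 * (K * b ^+ 2) by apply: ler_pM.
  lra.
have hF : deflation0_at lam i F by exact: flow_end hT hV flow.
have [hTF _ _] := hF.
have mF : m + 1 *: (F - m) = F by rewrite scale1r addrCA subrr addr0.
have fF : f F = lam i.
  rewrite -(sigma_deflated hF) sigU //.
  have := inr2 1; rewrite ler01 lexx mF => /(_ isT) h.
  by have [] := hr _ h.
have fm : `|f F - f m| <= N ^+ 2 * C * (K * b ^+ 2).
  have [||c c01] := @line_mean_value _ _ f m (F - m) 0 1 => //.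
    by move=> s /inr2 /hr [Us _ _]; exact: (sf [::]).
  rewrite mF scale0r addr0 subr0 mulr1 => ->.
  have [Uc _ hc] := hr _ (inr2 _ c01).
  apply: le_trans (derive_coord_bound _ _ hc) _; first exact: (sf [::]).
  by rewrite ler_wpM2l // mulr_ge0 // exprn_ge0.
have sec : `|f (m + `|b| *: coupling) + f (m - `|b| *: coupling) - 2 * f m|
    <= 2 * C * `|b| ^+ 2.
  apply: second_difference => // s; rewrite -ler_norml => /inr /hr [Us hs _] //.
    exact: (sf [::]).
  exact: (sf [:: coupling]).
have sigp : f (m + b *: coupling) = sigma T.
  rewrite decoupled_plus // sigU //.
  by have := hr _ (inr b (lexx _)); rewrite decoupled_plus // => -[].
have sigm : f (m - b *: coupling) = sigma T.
  rewrite decoupled_minus // -sigU.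
  - by apply: sigma_sym => //; exact: last_flip_sign.
  - exact: last_flip_TLambda.
  - rewrite -decoupled_minus //.
    by have := hr _ (inr (- b) _); rewrite normrN scaleNr => /(_ (lexx _)) [].
have {sec} : `|sigma T - f m| <= C * b ^+ 2.
  have E : f (m + `|b| *: coupling) + f (m - `|b| *: coupling) = 2 * sigma T.
    have [bp|bn] := ger0P b; first by rewrite sigp sigm; lra.
    by rewrite scaleNr opprK sigp sigm; lra.
  move: sec; rewrite E -mulrBr normrM real_normK ?num_real // ger0_norm //; lra.
move=> h; move: fm; rewrite fF => fm.
have := ler_normD (sigma T - f m) (f m - lam i).
rewrite addrA subrK => h'; apply: le_trans h' _.
rewrite mulrDl lerD // distrC; apply: le_trans fm _.
by rewrite mulrA.
Qed.

Variable eps : R.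
Hypothesis eps_gt0 : 0 < eps.
Hypothesis eps_delta : eps <= delta.
(* bounds the mass of the spectral measure away from lam_i by 1 / (16 N^2) *)
Hypothesis eps_gap : 8 * N * eps <= g.
(* gives |sigma T - lam_i| <= g / 8, so that a step does not increase |bot| *)
Hypothesis eps_shift : 8 * C0 * eps <= g.

Let N2 : 2 <= N. Proof. by rewrite /N ler_nat. Qed.

Let eps16 : 16 * eps <= g.
Proof.
apply: le_trans eps_gap; rewrite ler_wpM2r ?(ltW eps_gt0) //.
have := N2; lra.
Qed.

(** All that one step needs, for the index i of the eigenvalue near the corner
    entry. The step stays in the component because its new weight at i is at
    least 1/2 and |bot| does not increase. *)
Lemma shift_step T V i : TLambda lam T -> `|bot T| <= eps ->
  eigenbasis lam T V -> `|T ord_max ord_max - lam i| <= eps ->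
  [/\ N * (1 - weight V i) <= 2^-1,
      (1 - weight V i) * g ^+ 2 <= 4 * bot T ^+ 2,
      `|sigma T - lam i| <= C0 * `|bot T|,
      almost_invertible (T - (sigma T)%:M) /\
      deflation_at lam eps i (Fsigma sigma T) &
      `|bot (Fsigma sigma T)| <= 6 / g * `|sigma T - lam i| * `|bot T| ].
Proof.
move=> hT bT hV cT; have [Tsym tT _] := hT.
have [[[e0 g0] c0] n2] := (eps_gt0, g_gt0, C0_gt0, N2).
have [[e16 es] eg] := (eps16, eps_shift, eps_gap).
have g20 : 0 < g ^+ 2 by rewrite exprn_gt0.
have W : (1 - weight V i) * g ^+ 2 <= 4 * bot T ^+ 2.
  by apply: weight_large => //; lra.
have b2 : bot T ^+ 2 <= eps ^+ 2.
  by rewrite -[bot T ^+ 2]real_normK ?num_real // lerXn2r ?nnegrE ?(ltW eps_gt0).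
have NW : N * (1 - weight V i) <= 2^-1.
  rewrite -(ler_pM2r g20) -mulrA.
  have N0 : 0 <= N by lra.
  have W4 : (1 - weight V i) * g ^+ 2 <= 4 * eps ^+ 2 by lra.
  apply: le_trans (ler_wpM2l N0 W4) _.
  have h2 : 8 * N * eps * eps <= g * g.
    apply: ler_pM => //; [|exact: ltW|lra].
    by rewrite mulr_ge0 ?mulr_ge0 // ltW.
  rewrite !expr2; lra.
have w2 : 2^-1 <= weight V i.
  have x0 : 0 <= 1 - weight V i.
    by rewrite -weight_off ?hV.1 //; apply: sumr_ge0 => j _; exact: weight_ge0.
  have := ler_wpM2r x0 N2; lra.
have dT : deflation_at lam delta i T.
  by apply: deflation_at_weight hT hV w2 _; exact: le_trans eps_delta.
have S := sigma_near_at dT hT.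
have S8 : `|sigma T - lam i| <= g / 8.
  apply: le_trans S _; have := ler_wpM2l (ltW C0_gt0) bT; lra.
have Vi : V i ord_max != 0.
  apply: contraTneq w2; rewrite /weight => ->.
  by rewrite expr0n /= -ltNge invr_gt0 ltr0n.
have inj : injective_off_last (T - (sigma T)%:M).
  apply: shift_injective_off_last hV Vi _ => j ji.
  apply/eqP => lj; have := gap ji; rewrite lj; lra.
have [U hQ] := Qstar_spec inj; set Q := Qstar _ in hQ.
have [MQU [QQ _] hU dU] := hQ.
have tF : tridiagonal (Fsigma sigma T).
  apply: (tridiagonal_conj Tsym tT _ MQU QQ hU).
    by rewrite mulmxBr mulmxBl scalar_mxC.
  by move=> j /dU /lt0r_neq0.
have hF : TLambda lam (Fsigma sigma T) by exact: TLambda_conj.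
have hVF : eigenbasis lam (Fsigma sigma T) (V *m Q) by exact: eigenbasis_conj.
have gi j : j != i -> g <= `|lam j - lam i| by move=> ji; exact: gap.
have S4 : `|sigma T - lam i| <= g / 4 by lra.
have mom := shifted_moment Tsym hV hQ g_gt0 gi w2 S4.
have [Fsym _ _] := hF.
have bF : `|bot (Fsigma sigma T)| <= 6 / g * `|sigma T - lam i| * `|bot T|.
  have p0 : 0 <= 6 / g by rewrite divr_ge0 // ltW.
  rewrite -(@ler_pXn2r _ 2%N) ?nnegrE //; last first.
    by rewrite mulr_ge0 // mulr_ge0.
  rewrite !exprMn !real_normK ?num_real //.
  have : bot (Fsigma sigma T) ^+ 2
      <= 8 * (sigma T - lam i) ^+ 2 * (1 - weight V i).
    apply: le_trans mom; rewrite (weight_moment _ Fsym tF hVF) lerDl.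
    exact: sqr_ge0.
  move=> h; apply: le_trans h _.
  rewrite -(ler_pM2r g20) exprVn.
  have -> : 6 ^+ 2 * (g ^+ 2)^-1 * (sigma T - lam i) ^+ 2 * bot T ^+ 2 * g ^+ 2
    = 36 * (sigma T - lam i) ^+ 2 * bot T ^+ 2.
    by field; rewrite gt_eqF.
  have s0 : 0 <= (sigma T - lam i) ^+ 2 := sqr_ge0 _.
  have h1 := ler_wpM2l s0 W.
  have : 0 <= (sigma T - lam i) ^+ 2 * bot T ^+ 2 by rewrite mulr_ge0 ?sqr_ge0.
  lra.
split => //; split; first exact: almost_invertible_inj.
have w1 : 2^-1 <= weight (V *m Q) i.
  have := weight_concentration hVF.1 (ltW g_gt0) gi.
  move=> /le_trans /(_ mom) h.
  have s2 : (sigma T - lam i) ^+ 2 <= (g / 8) ^+ 2.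
    rewrite -[(sigma T - lam i) ^+ 2]real_normK ?num_real //.
    by rewrite lerXn2r ?nnegrE // divr_ge0 // ltW.
  have x1 : 1 - weight V i <= 1 by have := weight_ge0 V i; lra.
  have : (1 - weight (V *m Q) i) * g ^+ 2 <= 8 * (g / 8) ^+ 2.
    apply: le_trans h _.
    apply: (@le_trans _ _ (8 * (sigma T - lam i) ^+ 2)); last by lra.
    by rewrite ler_piMr // mulr_ge0 // sqr_ge0.
  have -> : 8 * (g / 8) ^+ 2 = 8^-1 * g ^+ 2 by field.
  rewrite ler_pM2r //; lra.
apply: deflation_at_weight hF hVF w1 _.
apply: le_trans bF _; apply: le_trans bT; rewrite ler_piMl //.
rewrite mulrAC ler_pdivrMr // mul1r; lra.
Qed.

Lemma deflation_index T : deflation lam eps T ->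
  exists V i, eigenbasis lam T V /\ `|T ord_max ord_max - lam i| <= eps.
Proof.
move=> [hT bT]; have [V hV] := TLambda_eigenbasis lam_inj hT.
have [Tsym tT _] := hT; have [i hi] := nearest_eigenvalue Tsym tT hV.
by exists V, i; split => //; rewrite distrC; exact: le_trans bT.
Qed.

Lemma deflation_at_invariant i :
  deflation_at lam eps i `<=` Fsigma_dom lam sigma /\
  Fsigma sigma @` deflation_at lam eps i `<=` deflation_at lam eps i.
Proof.
have step T : deflation_at lam eps i T -> TLambda lam T /\
    almost_invertible (T - (sigma T)%:M) /\
    deflation_at lam eps i (Fsigma sigma T).
  move=> dT.
  have e4 : 4 * eps <= g by have := eps16; have := eps_gt0; lra.
  have cT := deflation_at_corner lam_inj eps_gt0 e4 gap dT.
  have [T0 _ /connected_component_sub [hT bT]] := dT.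
  have [V hV] := TLambda_eigenbasis lam_inj hT.
  by have [_ _ _ h _] := shift_step hT bT hV cT.
split=> [T /step [hT [aT _]]|_ [T /step [_ [_ dT]] <-]] //.
Qed.

Lemma quadratic_convergence T : deflation lam eps T ->
  `|bot (Fsigma sigma T)| <= 6 * C0 / g * `|bot T| ^+ 2.
Proof.
move=> dT; have [V [i [hV cT]]] := deflation_index dT; have [hT bT] := dT.
have [_ _ S _ h] := shift_step hT bT hV cT; apply: le_trans h _.
rewrite expr2 !mulrA ler_wpM2r //.
rewrite [leRHS](_ : _ = 6 / g * (C0 * `|bot T|)); last by ring.
by rewrite ler_wpM2l // divr_ge0 // ltW.
Qed.

(** By compactness the constant only has to exist near each point T0 of K;
    compactness is used with the filter of large constants. *)
Lemma cubic_convergence (K : set 'M[R]_n.+2) : compact K ->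
  K `<=` deflation lam eps ->
  K `&` (singular_support (TLambda lam) sigma `&` deflation0 lam) = set0 ->
  exists2 C : R, 0 < C & forall T, K T ->
    `|bot (Fsigma sigma T)| <= C * `|bot T| ^+ 3.
Proof.
move=> /compact_near_coveringP cK KD KS.
pose P (C : R) T := K T -> `|bot (Fsigma sigma T)| <= C * `|bot T| ^+ 3.
suff : \forall C \near +oo, K `<=` P C.
  move=> h; have : \forall C \near +oo, 0 < C /\ K `<=` P C.
    by apply: filterI => //; exact: nbhs_pinfty_gt.
  by move=> /(@filter_ex _ _ _) [C [C0' KP]]; exists C => // T KT; exact: KP.
apply: cK => T0 KT0.
suff [rho [C [rho0 hC]]] : exists rho C : R, 0 < rho /\
    forall T, `|T - T0| < rho -> P C T.
  exists (ball T0 rho, [set D | C < D]).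
    by split => /=; [exact: nbhsx_ballx|apply: nbhs_pinfty_gt; exact: num_real].
  move=> [T D] /= [T0T CD] KT; rewrite -ball_normE /ball_ /= distrC in T0T.
  apply: le_trans (hC _ T0T KT) _.
  by rewrite ler_wpM2r ?exprn_ge0 // ltW.
have [hT0 bT0] := KD _ KT0.
have [b0|b0] := eqVneq (bot T0) 0.
  have nS : ~ singular_support (TLambda lam) sigma T0.
    by move=> sT0; suff: (set0 : set 'M[R]_n.+2) T0 by []; rewrite -KS; split.
  have [rho [C [rho0 C0' hC]]] := quadratic_near_regular hT0 b0 nS.
  exists rho, (6 / g * C); split => // T TT0 KT.
  have dT := KD _ KT; have [V [i [hV cT]]] := deflation_index dT.
  have [hT bT] := dT; have [Nx xg _ _ h] := shift_step hT bT hV cT.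
  have {}hC := hC _ _ _ TT0 hT hV Nx xg.
  apply: le_trans h _; rewrite exprSr mulrA ler_wpM2r // -[leRHS]mulrA.
  rewrite ler_wpM2l ?divr_ge0 ?(ltW g_gt0) //.
  by rewrite real_normK ?num_real.
have n0 : 0 < `|bot T0| by rewrite normr_gt0.
exists (`|bot T0| / 2), (6 * C0 / g * (2 / `|bot T0|)); split.
  by rewrite divr_gt0.
move=> T TT0 KT; have dT := KD _ KT.
apply: le_trans (quadratic_convergence dT) _.
have p0 : 0 <= 6 * C0 / g.
  by rewrite divr_ge0 ?mulr_ge0 ?(ltW C0_gt0) ?(ltW g_gt0).
rewrite -[leRHS]mulrA ler_wpM2l // [_ ^+ 3]exprS [leRHS]mulrA.
rewrite ler_peMl ?exprn_ge0 //.
have : `|bot T0 - bot T| <= `|T - T0|.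
  rewrite distrC; have := mx_norm_ge (T - T0) ord_max (inord n).
  by rewrite /bot !mxE.
have := ler_normD (bot T0 - bot T) (bot T); rewrite subrK => h1 h2.
rewrite mulrAC ler_pdivlMr // mul1r; lra.
Qed.

End Main.

Theorem theorem2 (R : realType) (n : nat) (lam : 'I_n.+2 -> R)
    (hlam : forall i j : 'I_n.+2, (i < j)%N -> lam i < lam j)
    (sigma : 'M[R]_n.+2 -> R)
    (hsigma : simple_shift_strategy lam sigma)
    (hcompat : deflation_compatible lam sigma) :
  exists2 eps0 : R, 0 < eps0 & forall eps : R, 0 < eps -> eps <= eps0 ->
    [/\ forall i : 'I_n.+2,
          deflation_at lam eps i `<=` Fsigma_dom lam sigma /\
          Fsigma sigma @` deflation_at lam eps i `<=` deflation_at lam eps i,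
        exists2 C : R, 0 < C & forall T, deflation lam eps T ->
          `|bot (Fsigma sigma T)| <= C * `|bot T| ^+ 2
      & forall K : set 'M[R]_n.+2, compact K -> K `<=` deflation lam eps ->
          K `&` (singular_support (TLambda lam) sigma `&` deflation0 lam)
            = set0 ->
          exists2 C : R, 0 < C & forall T, K T ->
            `|bot (Fsigma sigma T)| <= C * `|bot T| ^+ 3].
Proof.
have lam_inj : injective lam.
  move=> i j lij; case: (ltngtP i j) => [/hlam|/hlam|/val_inj //];
    by rewrite lij ltxx.
have [sym [C0 C0_gt0 near]] := hsigma.
have [delta delta_gt0 compat] := hcompat.
have [g g_gt0 gap] := eigenvalue_gap lam_inj.
have N0 : 0 < 8 * n.+2%:R :> R by rewrite mulr_gt0.
have C8 : 0 < 8 * C0 by rewrite mulr_gt0.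
exists (Num.min delta (Num.min (g / (8 * n.+2%:R)) (g / (8 * C0)))).
  by rewrite !lt_min delta_gt0 !divr_gt0.
move=> eps eps_gt0; rewrite !le_min => /and3P[e1 e2 e3].
have e2' : 8 * n.+2%:R * eps <= g by rewrite mulrC -ler_pdivlMr.
have e3' : 8 * C0 * eps <= g by rewrite mulrC -ler_pdivlMr.
split.
- exact: (deflation_at_invariant lam_inj C0_gt0 near compat g_gt0 gap
    eps_gt0 e1 e2' e3').
- exists (6 * C0 / g); first by rewrite divr_gt0 // mulr_gt0.
  exact: (quadratic_convergence lam_inj C0_gt0 near compat g_gt0 gap
    eps_gt0 e1 e2' e3').
- exact: (cubic_convergence lam_inj C0_gt0 sym near delta_gt0 compat g_gt0 gap
    eps_gt0 e1 e2' e3').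
Qed.
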